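(* Let $\mathbb{K}$ be an algebraically closed field of characteristic not $2$, and let $\mathfrak{g}$ be a $2$-step nilpotent Lie algebra of genus $2$ over $\mathbb{K}$, whose associated pencil (with respect to some basis) has minimal indices $\varepsilon_1,\ldots,\varepsilon_k$ and pairs of elementary divisors \[ (\infty,e_1),\ldots,(\infty,e_s),\; (\alpha_1,f_1),\ldots,(\alpha_l,f_l) \] with $\alpha_j\in\mathbb{K}$ for all $1\le j\le l$. Then \[ \dim(\mathrm{AID}(\mathfrak{g}))=\dim(\mathrm{Inn}(\mathfrak{g}))+\sum_{j=1,\ \varepsilon_j\neq 0}^{k}(\varepsilon_j-1)+2\sum_{j=1}^{s}(e_j-1)+2\sum_{j=1}^{l}(f_j-1). \]
   Context: All Lie algebras are finite-dimensional. A Lie algebra $\mathfrak{g}$ over $\mathbb{K}$ is $2$-step nilpotent if $[\mathfrak{g},[\mathfrak{g},\mathfrak{g}]]=0$; a $2$-step nilpotent $\mathfrak{g}$ has genus $2$ if $\dim([\mathfrak{g},\mathfrak{g}])=2$. A derivation $D$ of $\mathfrak{g}$ is almost inner if $D(x)\in[\mathfrak{g},x]$ for all $x\in\mathfrak{g}$; $\mathrm{AID}(\mathfrak{g})$ is the space of almost inner derivations and $\mathrm{Inn}(\mathfrak{g})$ the space of inner derivations. Associated pencil: choose a basis $(x_1,\ldots,x_n,y_1,y_2)$ of $\mathfrak{g}$ with $(y_1,y_2)$ a basis of $[\mathfrak{g},\mathfrak{g}]$, and write $[x_i,x_j]=a_{ij}y_1+b_{ij}y_2$, $A=(a_{ij})$,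 $B=(b_{ij})$. The skew pencil associated to $\mathfrak{g}$ with respect to this basis is $\mu A+\lambda B\in M_n(\mathbb{K}[\lambda,\mu])$. Elementary divisors: let $r$ be the rank of $\mu A+\lambda B$ (over $\mathbb{K}(\lambda,\mu)$). For $1\le m\le r$ let $G_m(\mu,\lambda)$ be the greatest common divisor of all minors of order $m$ of $\mu A+\lambda B$, and put $i_1=G_1$, $i_m=G_m/G_{m-1}$ for $1<m\le r$ (the invariant factors). The elementary divisors are the prime power factors (up to scalars) occurring in the factorizations of $i_1,\ldots,i_r$ into powers of pairwise non-associate primes of $\mathbb{K}[\lambda,\mu]$, listed with multiplicity (over all $m$). For a skew pencil over $\mathbb{K}$ the elementary divisors occur in pairs: $(\infty,e)$ denotes the pair $\mu^e,\mu^e$, and $(\alpha,f)$ with $\alpha\in\mathbb{K}$ denotes the pair $(\lambda-\mu\alpha)^f,(\lambda-\mu\alpha)^f$, where $e,f\ge 1$. The list in the claim is the complete list of these pairs (repetitions allowed, and the $\alpha_j$ need not be distinct). Minimal indices: if $\mu A+\lambda B$ is singular (its determinant is the zero polynomial), choose a nonzero solution $x_1(\lambda)\in\mathbb{K}[\lambda]^n$ of $(A+\lambda B)x=0$ of minimal degree $\varepsilon_1$; then among solutions that are $\mathbb{K}[\lambda]$-linearly independent of $x_1(\lambda)$ choose $x_2(\lambda)$ of minimal degree $\varepsilon_2$; continue in this way (each new solution of minimal degree among those $\mathbb{K}[\lambda]$-independent of the previous ones) until a maximal $\mathbb{K}[\lambda]$-independent set $x_1(\lambda),\ldots,x_k(\lambda)$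 of solutions is obtained. The degrees $\varepsilon_1\le\cdots\le\varepsilon_k$ do not depend on the choices and are the minimal indices. If the pencil is not singular, there are no minimal indices ($k=0$). *)

(* Defs.v *)
From HB Require Import structures.
From mathcomp Require Import all_boot all_order all_algebra.
From mathcomp Require Import boolp.

Set Implicit Arguments.
Unset Strict Implicit.
Unset Printing Implicit Defensive.

Import GRing.Theory.
Local Open Scope ring_scope.

HB.mixin Record hasLieBracket (K : fieldType) (V : Type) of Vector K V := {
  lie : V -> V -> V;
  lie_linearl : forall z : V, linear (fun x => lie x z);
  lie_linearr : forall z : V, linear (fun x => lie z x);
  liexx : forall x : V, lie x x = 0;
  lie_jacobi : forall x y z : V,
    lie x (lie y z) + lie y (lie z x) + lie z (lie x y) = 0
}.

#[short(type="lieAlgType")]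
HB.structure Definition LieAlgebra (K : fieldType) :=
  { V of Vector K V & hasLieBracket K V }.

Section LieAlgebra.
Variables (K : fieldType) (g : lieAlgType K).
Implicit Types (U W : {vspace g}) (x y z : g) (D : 'End(g)).

HB.instance Definition _ z :=
  GRing.isLinear.Build K g g *:%R (@lie K g z) (lie_linearr z).

Definition liev U W : {vspace g} :=
  <<[seq lie x y | x <- vbasis U, y <- vbasis W]>>%VS.

Lemma lie0l z : lie 0 z = 0 :> g.
Proof.
by have := lie_linearl z (-1) 0 0; rewrite scaler0 addr0 scaleN1r addNr.
Qed.

Lemma lieZl a x z : lie (a *: x) z = a *: lie x z :> g.
Proof. by rewrite -[a *: x]addr0 lie_linearl lie0l addr0. Qed.

Lemma lieDl x y z : lie (x + y) z = lie x z + lie y z :> g.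
Proof. by rewrite -[x]scale1r lie_linearl !scale1r. Qed.

Lemma mem_liev U W x y : x \in U -> y \in W -> lie x y \in liev U W.
Proof.
move=> xU yW; rewrite (coord_vbasis xU) (coord_vbasis yW).
rewrite (big_morph (fun u => lie u _) (fun u v => lieDl u v _) (lie0l _)).
apply: memv_suml => i _; rewrite lieZl memvZ // linear_sum.
apply: memv_suml => j _; rewrite linearZ memvZ //.
by apply/memv_span/allpairs_f; rewrite mem_nth // size_tuple.
Qed.

Definition derived_algebra : {vspace g} := liev fullv fullv.

Definition two_step_nilpotent : Prop := liev fullv derived_algebra = 0%VS.

Definition genus2 : Prop := \dim derived_algebra = 2%N.

Definition is_derivation D : Prop :=
  forall x y, D (lie x y) = lie (D x) y + lie x (D y).

Definition almost_inner D : Prop :=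
  is_derivation D /\ forall x, exists y, D x = lie y x.

Definition ad x : 'End(g) := linfun (lie x).

Lemma ad_linear : linear ad.
Proof.
move=> a x y; apply/lfunP => z.
by rewrite add_lfunE scale_lfunE !lfunE /= lie_linearl.
Qed.

HB.instance Definition _ := GRing.isLinear.Build K g 'End(g) *:%R ad ad_linear.

Definition Inn : {vspace 'End(g)} := limg (linfun ad).

Lemma InnP D : D \in Inn <-> exists x, D = ad x.
Proof.
split=> [/memv_imgP[x _ ->]|[x ->]]; first by exists x; rewrite lfunE.
by apply/memv_imgP; exists x; rewrite ?memvf ?lfunE.
Qed.

End LieAlgebra.

Lemma submod_vspace (K : fieldType) (W : vectType K) (P : W -> Prop) :
  P 0 -> (forall a u v, P u -> P v -> P (a *: u + v)) ->
  exists U : {vspace W}, forall u, u \in U <-> P u.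
Proof.
move=> P0 Plin.
suff aux n (U : {vspace W}) : (\dim {:W} - \dim U <= n)%N ->
    (forall u, u \in U -> P u) -> exists U' : {vspace W}, forall u, u \in U' <-> P u.
  by apply: (aux _ 0%VS (leqnn _)) => u; rewrite memv0 => /eqP->.
elim: n U => [|n IHn] U leUn UP.
  exists U => u; split=> [/UP//|_].
  suff -> : U = fullv by rewrite memvf.
  by apply/eqP; rewrite eqEdim subvf -subn_eq0 -leqn0.
have [[u uP uU]|nU] := pselect (exists2 u, P u & u \notin U); last first.
  exists U => u; split=> [/UP//|uP]; apply: contrapT => /negP uU.
  by apply: nU; exists u.
have dimUu : (\dim U < \dim (<[u]> + U))%N.
  rewrite ltn_neqAle dimvS ?addvSr // andbT; apply: contra uU => eqd.
  have /eqP-> : U == (<[u]> + U)%VS by rewrite eqEdim addvSr -(eqP eqd) /=.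
  by rewrite memvE addvSl.
apply: (IHn (<[u]> + U)%VS).
  have leW : (\dim (<[u]> + U) <= \dim {:W})%N by rewrite dimvS ?subvf.
  by rewrite leq_subLR (leq_trans _ (leq_add dimUu (leqnn n))) // addSnnS -leq_subLR.
by move=> _ /memv_addP[_ /vlineP[a ->] [v vU ->]]; apply: Plin => //; apply: UP.
Qed.

Section AID.
Variables (K : fieldType) (g : lieAlgType K).

Lemma AID_subproof :
  exists U : {vspace 'End(g)}, forall D, D \in U <-> almost_inner D.
Proof.
apply: submod_vspace => [|a D E [dD iD] [dE iE]]; split.
- by move=> x y; rewrite !zero_lfunE lie0l linear0 addr0.
- by move=> x; exists 0; rewrite zero_lfunE lie0l.
- move=> x y; rewrite !add_lfunE !scale_lfunE dD dE !lieDl !lieZl !linearD !linearZ /=.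
  by rewrite addrACA.
- move=> x; have [y Dx] := iD x; have [z Ex] := iE x.
  by exists (a *: y + z); rewrite add_lfunE scale_lfunE Dx Ex lieDl lieZl.
Qed.

Definition AID : {vspace 'End(g)} := sval (cid AID_subproof).

Lemma AIDP (D : 'End(g)) : D \in AID <-> almost_inner D.
Proof. exact: (svalP (cid AID_subproof)). Qed.

End AID.

Definition associated_pencil (K : fieldType) (g : lieAlgType K) (n : nat)
    (A B : 'M[K]_n) : Prop :=
  exists (x : n.-tuple g) (y1 y2 : g),
    [/\ basis_of fullv (x ++ [:: y1; y2]),
        basis_of (derived_algebra g) [:: y1; y2]
      & forall i j, lie (tnth x i) (tnth x j) = A i j *: y1 + B i j *: y2].

Section Pencil.
Variable K : fieldType.

(** [K[lambda, mu]] is represented as [K[lambda][mu]]. *)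
Local Notation Klm := {poly {poly K}}.

Definition lambda : Klm := 'X%:P.
Definition mu : Klm := 'X.
Definition scal (c : K) : Klm := c%:P%:P.

Definition pencil n (A B : 'M[K]_n) : 'M[Klm]_n :=
  mu *: map_mx scal A + lambda *: map_mx scal B.

Definition affine_pencil n (A B : 'M[K]_n) : 'M[{poly K}]_n :=
  map_mx polyC A + 'X *: map_mx polyC B.

End Pencil.

Arguments lambda {K}.
Arguments mu {K}.

(** The divisibility and gcd of [polydiv] are only pseudo-division notions when
    the coefficients do not form a field, hence the ring-theoretic versions. *)
Section Divisibility.
Variable R : idomainType.
Implicit Types (d p q : R) (f : seq (R * nat)).

Definition divides d p : Prop := exists q, p = q * d.

Definition associated p q : Prop := exists2 c, c \is a GRing.unit & p = c * q.

Definition is_gcd (S : R -> Prop) d : Prop :=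
  (forall p, S p -> divides d p) /\
  (forall d', (forall p, S p -> divides d' p) -> divides d' d).

Definition prime_elt p : Prop :=
  [/\ p != 0, p \isn't a GRing.unit
    & forall a b, divides p (a * b) -> divides p a \/ divides p b].

(** [f] lists the pairs (prime, exponent). *)
Definition prime_factorization p f : Prop :=
  [/\ forall pe, pe \in f -> prime_elt pe.1 /\ (0 < pe.2)%N,
      forall i j, (i < j < size f)%N ->
        ~ associated (nth (0, 0%N) f i).1 (nth (0, 0%N) f j).1
    & associated p (\prod_(pe <- f) pe.1 ^+ pe.2)].

Variable n : nat.
Implicit Type M : 'M[R]_n.

Definition is_minor M m p : Prop :=
  exists r c : 'I_m -> 'I_n,
    [/\ {homo r : i j / (i < j)%N}, {homo c : i j / (i < j)%N}
      & p = \det (mxsub r c M)].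

Definition frac_rank M : nat := \rank (map_mx (@tofrac R) M).

(** [s`_m] is the [m.+1]-st invariant factor; as gcds are only defined up to
    units, so are the invariant factors. *)
Definition invariant_factors M (s : seq R) : Prop :=
  size s = frac_rank M /\
  exists G : nat -> R,
    [/\ forall m, (1 <= m <= size s)%N -> is_gcd (is_minor M m) (G m),
        (0 < size s)%N -> s`_0 = G 1%N
      & forall m, (1 <= m < size s)%N -> s`_m * G m = G m.+1].

(** The members of [E] need no separate "up to a unit" clause: the primes in the
    factorizations [F] can be replaced by associates, and over an algebraically
    closed field of constants [c * p ^+ e] is itself an [e]-th power. *)
Definition elementary_divisors M (E : seq R) : Prop :=
  exists (s : seq R) (F : seq (seq (R * nat))),
    [/\ invariant_factors M s,
        size F = size s,
        forall m, (m < size s)%N -> prime_factorization s`_m (nth [::] F m)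
      & perm_eq E [seq pe.1 ^+ pe.2 | pe <- flatten F]].

End Divisibility.

(** The elementary divisors denoted by the pairs [(oo, e)], [e] in [es], and
    [(alpha, f)] in [afs]. *)
Definition paired_divisors (K : fieldType) (es : seq nat) (afs : seq (K * nat)) :
    seq {poly {poly K}} :=
  flatten [seq [:: mu ^+ e; mu ^+ e] | e <- es] ++
  flatten [seq nseq 2 ((lambda - mu * scal af.1) ^+ af.2) | af <- afs].

Definition lin_indep (R : nzRingType) (V : lmodType R) (s : seq V) : Prop :=
  forall c : 'I_(size s) -> R,
    \sum_i c i *: s`_i = 0 -> forall i, c i = 0.

Section MinimalIndices.
Variables (K : fieldType) (n : nat).
Implicit Types (A B : 'M[K]_n) (z : 'cV[{poly K}]_n).

Definition vdeg z : nat := (\max_i size (z i ord0)).-1.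

Definition is_solution A B z : Prop := affine_pencil A B *m z = 0.

Definition minimal_solutions A B (x : seq 'cV[{poly K}]_n) : Prop :=
  [/\ forall j, (j < size x)%N ->
        [/\ is_solution A B x`_j,
            lin_indep (take j.+1 x)
          & forall z, is_solution A B z -> lin_indep (rcons (take j x) z) ->
              (vdeg x`_j <= vdeg z)%N]
    & forall z, is_solution A B z -> ~ lin_indep (rcons x z)].

Definition minimal_indices A B (eps : seq nat) : Prop :=
  if \det (pencil A B) == 0 then
    exists2 x, minimal_solutions A B x & eps = [seq vdeg z | z <- x]
  else eps = [::].

End MinimalIndices.

(* Main.v *)
Require Import Defs.
From HB Require Import structures.
From mathcomp Require Import all_boot all_order all_fingroup all_algebra.
From mathcomp Require Import boolp zify ring.
From mathcomp Require Import generic_quotient.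

Set Implicit Arguments.
Unset Strict Implicit.
Unset Printing Implicit Defensive.

Import GRing.Theory.
Local Open Scope ring_scope.

(** An almost inner derivation [D] vanishes on the derived algebra and takes values in it, so it
    is given by a pair [(p, q)] of row vectors, [D u = (p u) y1 + (q u) y2].  It is
    almost inner exactly when, for every [u], the pair [(p u, q u)] is of the form
    [(w A u, w B u)]; by duality in the plane this means that at every point [(c, d)]
    of the projective line the vector [c p + d q] lies in the row space of [c A + d B]
    ([almost_innerP], [local_space1P]).  So the vectors to be counted are the
    polynomial vectors [v = p + 'X q] of degree 1 whose value at each point is in the
    row space of the pencil at this point.

    Let [r] be the generic rank and let [Z] have the [k = n - r] minimal solutions as columns.
    At the points where the rank is [r] the condition just says that [v Z] vanishes at the point;
    at the finitely many others there are additional conditions, as many as the rank drops.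
    The equation [v Z = 0] amounts to [eps j + 2] linear conditions for the minimal index
    [eps j].  If all these conditions are independent, the dimension is

      [2 r - (sum of the minimal indices) - (sum of the rank drops)].

    Counting conditions bounds the dimension from below.  For vectors of large degree the
    conditions are independent, by interpolation: minimality of the degrees makes
    the values of [Z] at each point, and its leading coefficients, linearly independent
    ([minimal_solutions_at], [minimal_solutions_leading]), hence [Z] has a polynomial
    left inverse.  One returns to degree 1 by [dim_local_space_step], which
    shows that raising the degree by one raises the dimension by at least [r]; the point is
    that the rows of the pencil are themselves admissible vectors of degree 1.

    Two facts translate this into the stated formula.  First, the rank drop at a point is
    the number of elementary divisors belonging to it ([elementary_divisors_count]): an
    invariant factor beyond the rank at the point is divisible by the corresponding prime,
    which follows from the adjugate identity ([minor_divides_exp_step]).  Second, [r] is twice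
    the sum of the minimal indices plus the sum of the degrees of all elementary divisors
    ([minimal_indices_degree_formula]).  Indeed the minors of order [r] factor as
    their gcd times two complementary minors of [Z], one for the rows and, as the pencil is
    skew-symmetric, another one for the columns ([minors_factor]); the complementary minors
    have no common root and their degree attains the sum of the minimal indices.

    Finally, the inner derivations have dimension [n] minus the number of
    minimal indices equal to 0 ([dim_Inn], [constant_solutions]), which explains why these
    indices are left out of the sum. *)

(** * Minors *)

Lemma det_mulmx_rowsub (R : comNzRingType) m n (X : 'M[R]_(m, n)) (N : 'M[R]_(n, m)) :
  \det (X *m N) =
    \sum_(f : {ffun 'I_m -> 'I_n}) (\prod_i X i (f i)) * \det (rowsub f N).
Proof.
rewrite {1}/determinant; under eq_bigr => s _.
  under eq_bigr do rewrite mxE.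
  rewrite bigA_distr_bigA big_distrr; over.
rewrite exchange_big; apply: eq_bigr => f _; rewrite big_distrr; apply: eq_bigr => s _ /=.
rewrite big_split mulrCA; congr (_ * (_ * _)).
by apply: eq_bigr => i _; rewrite mxE.
Qed.

Lemma sorted_factor m n (f : 'I_m -> 'I_n) : injective f ->
  exists (s : 'S_m) (h : 'I_m -> 'I_n),
    {homo h : i j / (i < j)%N} /\ f =1 h \o s.
Proof.
move=> f_inj; pose A := [set f i | i : 'I_m].
have cA : #|A| = m by rewrite card_imset // card_ord.
pose h (i : 'I_m) : 'I_n := enum_val (cast_ord (esym cA) i).
have fA i : f i \in A by apply: imset_f.
pose s0 i : 'I_m := cast_ord cA (enum_rank_in (fA i) (f i)).
have hs0 i : h (s0 i) = f i by rewrite /h /s0 cast_ordK enum_rankK_in.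
have s0_inj : injective s0 by move=> i j e; apply: f_inj; rewrite -!hs0 e.
exists (perm s0_inj), h; split=> [i j lt_ij|i]; last by rewrite /= permE hs0.
have x0 : 'I_n := f i.
have srt : sorted ltn [seq val x | x <- enum A].
  rewrite sorted_map; apply: (@subseq_sorted _ _ _ _ (enum 'I_n)).
  - by move=> a b c /=; apply: ltn_trans.
  - by rewrite [enum 'I_n]enumT; apply: filter_subseq.
  - by have := iota_ltn_sorted 0 n; rewrite -val_enum_ord sorted_map.
have sz k : (k < m)%N -> (k < size (enum A))%N by rewrite -cardE cA.
rewrite /h !(enum_val_nth x0) /= -(nth_map x0 0%N val) ?sz //.
rewrite -(nth_map x0 0%N val) ?sz //.
by have := sorted_ltn_nth ltn_trans 0%N srt; apply; rewrite ?inE ?size_map ?sz.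
Qed.

Section Minors.
Variable R : idomainType.
Implicit Types m n : nat.

Lemma det_mxsub_minor n (M : 'M[R]_n) m (f g : 'I_m -> 'I_n) :
  \det (mxsub f g M) = 0 \/
  exists b : bool, exists2 p, is_minor M m p & \det (mxsub f g M) = (-1) ^+ b * p.
Proof.
have [/injectiveP f_inj|] := boolP (injectiveb f); last first.
  move=> /injectivePn[i [j ij fij]]; left.
  by apply: (determinant_alternate ij) => l; rewrite !mxE fij.
have [/injectiveP g_inj|] := boolP (injectiveb g); last first.
  move=> /injectivePn[i [j ij gij]]; left; rewrite -det_tr.
  by apply: (determinant_alternate ij) => l; rewrite !mxE gij.
have [s [h [h_mono fE]]] := sorted_factor f_inj.
have [t [k [k_mono gE]]] := sorted_factor g_inj.
right; exists (s (+) t); exists (\det (mxsub h k M)); first by exists h, k.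
have -> : mxsub f g M = row_perm s (col_perm t (mxsub h k M)).
  by apply/matrixP => i j; rewrite !mxE fE gE.
rewrite row_permE col_permE !det_mulmx !det_perm odd_permV signr_addb.
by rewrite -mulrA; congr (_ * _); rewrite mulrC.
Qed.

(** By multilinearity in rows and columns, the minors of order [m] generate
    the determinants of all [m] by [m] matrices obtained from [M] by
    multiplication on both sides.  Restricting the scalars to [C] allows
    a [P] that is only stable under scaling by constants. *)
Lemma minor_closed_det (C P : R -> Prop) n (M : 'M[R]_n) m :
    C 1 -> C (- 1) -> (forall a b, C a -> C b -> C (a * b)) ->
    P 0 -> (forall p q, P p -> P q -> P (p + q)) ->
    (forall a p, C a -> P p -> P (a * p)) -> (forall p, is_minor M m p -> P p) ->
  forall (X : 'M_(m, n)) (Y : 'M_(n, m)), (forall i j, C (X i j)) ->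
    (forall i j, C (Y i j)) -> P (\det (X *m M *m Y)).
Proof.
move=> C1 CN1 CM P0 PD PM Pm X Y XC YC.
have Psum (I : finType) (F : I -> R) : (forall i, P (F i)) -> P (\sum_i F i).
  by move=> PF; apply: (big_ind P) => // i _.
have Cprod (F : 'I_m -> R) : (forall i, C (F i)) -> C (\prod_i F i).
  by move=> CF; apply: (big_ind C) => // i _.
have Pmxsub (f g : 'I_m -> 'I_n) : P (\det (mxsub f g M)).
  have [-> //|[b [p pm ->]]] := det_mxsub_minor M f g.
  by apply: PM; [case: b | apply: Pm].
rewrite -mulmxA det_mulmx_rowsub; apply: (Psum) => f; apply: (PM); first exact: Cprod.
rewrite -det_tr -mul_rowsub_mx trmx_mul det_mulmx_rowsub; apply: Psum => g; apply: PM.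
  by apply: Cprod => i; rewrite mxE.
have -> : rowsub g (rowsub f M)^T = (mxsub f g M)^T.
  by apply/matrixP => i j; rewrite !mxE.
by rewrite det_tr.
Qed.

Lemma mxsub_delta n (M : 'M[R]_n) m (f g : 'I_m -> 'I_n) :
  mxsub f g M = rowsub f 1%:M *m M *m colsub g 1%:M.
Proof. by rewrite mul_rowsub_mx mul1mx mulmx_colsub mulmx1 -mxsubcr. Qed.

Lemma minor_map (S : idomainType) (h : {rmorphism R -> S}) n (M : 'M[R]_n) m q :
  is_minor (map_mx h M) m q <-> exists2 p, is_minor M m p & q = h p.
Proof.
split=> [[f [g [hf hg ->]]]|[p [f [g [hf hg ->]]] ->]].
  by exists (\det (mxsub f g M)); [exists f, g | rewrite -map_mxsub det_map_mx].
by exists f, g; split=> //; rewrite -map_mxsub det_map_mx.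
Qed.

End Minors.

Lemma rank_minor (F : fieldType) n (M : 'M[F]_n) m :
  (m <= \rank M)%N <-> exists2 p, is_minor M m p & p != 0.
Proof.
split=> [le_m|[p [f [g [_ _ ->]]] det_n0]]; last first.
  have unit_sub : mxsub f g M \in unitmx by rewrite unitmxE unitfE.
  rewrite -(mxrank_unit unit_sub) mxsubrc; apply: leq_trans (mxrankS (rowsub_sub _ _)) _.
  by rewrite -mxrank_tr trmx_mxsub -(mxrank_tr M) mxrankS ?rowsub_sub.
apply: contrapT => no_minor.
have le_mn : (m <= n)%N by apply: leq_trans le_m (rank_leq_row M).
have PX : forall (X : 'M_(m, n)) (Y : 'M_(n, m)), \det (X *m M *m Y) = 0.
  move=> X Y.
  apply: (@minor_closed_det _ (fun=> True) (fun p => p = 0)) => //.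
  - by move=> p q -> ->; rewrite addr0.
  - by move=> a p _ ->; rewrite mulr0.
  by move=> p pm; apply: contrapT => /eqP p_n0; apply: no_minor; exists p.
(* Gaussian elimination gives [X] and [Y] for which the product is the identity. *)
have := PX (pid_mx m *m invmx (col_ebase M)) (invmx (row_ebase M) *m pid_mx m).
rewrite -{2}(mulmx_ebase M) !mulmxA mulmxKV ?col_ebase_unit //.
rewrite mulmxK ?row_ebase_unit // !mul_pid_mx.
rewrite (_ : minn _ (minn _ m) = m); last by lia.
by rewrite pid_mx_1 det1 => /eqP; rewrite oner_eq0.
Qed.

(** * Homogenization *)

Section Homogenization.
Variable K : fieldType.
Implicit Types (p q : {poly K}) (a : K).

(** [homog d p] is [mu ^ d * p (lambda / mu)] when [p] has degree at most [d]. *)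
Definition homog d p : {poly {poly K}} :=
  \sum_(i < d.+1) scal p`_i * (lambda ^+ i * mu ^+ (d - i)).

Lemma homogD d p q : homog d (p + q) = homog d p + homog d q.
Proof.
rewrite /homog -big_split /=; apply: eq_bigr => i _.
by rewrite coefD /scal !polyCD mulrDl.
Qed.

Lemma homogZ d a p : homog d (a *: p) = scal a * homog d p.
Proof.
by rewrite big_distrr; apply: eq_bigr => i _; rewrite coefZ /scal !polyCM -!mulrA.
Qed.

Lemma homog0 d : homog d 0 = 0.
Proof. by rewrite -[X in homog d X](scale0r 0) homogZ /scal !polyC0 mul0r. Qed.

Lemma homog_sum d (I : Type) (r : seq I) (F : I -> {poly K}) :
  homog d (\sum_(i <- r) F i) = \sum_(i <- r) homog d (F i).
Proof. by apply: (big_morph (homog d)) => [p q|]; rewrite ?homogD ?homog0. Qed.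

Lemma homogXn d i : (i <= d)%N -> homog d 'X^i = lambda ^+ i * mu ^+ (d - i).
Proof.
move=> le_id; have lt_id : (i < d.+1)%N by [].
rewrite /homog (bigD1 (Ordinal lt_id)) //= coefXn eqxx /scal !polyC1 mul1r.
rewrite big1 ?addr0 // => j ne_ji; rewrite coefXn; case: eqP => [e|_].
  by case/eqP: ne_ji; apply: val_inj.
by rewrite /= !polyC0 mul0r.
Qed.

Lemma poly_sumZXn n p : (size p <= n)%N -> p = \sum_(i < n) p`_i *: 'X^i.
Proof.
move=> le_pn; rewrite -poly_def; apply/polyP => i; rewrite coef_poly.
by case: ltnP => // le_ni; rewrite nth_default // (leq_trans le_pn).
Qed.

Lemma homogM d e p q : (size p <= d.+1)%N -> (size q <= e.+1)%N ->
  homog (d + e) (p * q) = homog d p * homog e q.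
Proof.
move=> le_p le_q; rewrite {1}(poly_sumZXn le_p) {1}(poly_sumZXn le_q).
rewrite big_distrl homog_sum [RHS]big_distrl; apply: eq_bigr => i _ /=.
rewrite big_distrr homog_sum [RHS]big_distrr; apply: eq_bigr => j _ /=.
rewrite -scalerAl -scalerAr !homogZ -exprD homogXn; last first.
  by case: i j => i ? [j ?] /=; lia.
have -> : (d + e - (i + j) = (d - i) + (e - j))%N by case: i j => i ? [j ?] /=; lia.
by rewrite !exprD; ring.
Qed.

Lemma homog_prod (I : Type) (s : seq I) (F : I -> {poly K}) :
    (forall i, size (F i) <= 2)%N ->
  (size (\prod_(i <- s) F i)%R <= (size s).+1)%N /\
  homog (size s) (\prod_(i <- s) F i) = \prod_(i <- s) homog 1 (F i).
Proof.
move=> leF; elim: s => [|i s [le_s hs]].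
  rewrite !big_nil size_poly1; split=> //.
  by rewrite -[X in homog _ X](expr0 'X) homogXn // !expr0 mulr1.
rewrite !big_cons -hs -homogM // add1n; split=> //.
have := leF i; have := size_polyMleq (F i) (\prod_(j <- s) F j).
by move: le_s; rewrite /=; lia.
Qed.

Lemma homog_horner1 d p : (size p <= d.+1)%N -> (homog d p).[1] = p.
Proof.
move=> le_p; rewrite [RHS](poly_sumZXn le_p) horner_sum; apply: eq_bigr => i _.
by rewrite /scal /lambda /mu -polyC_exp !hornerM !hornerC hornerXn expr1n mulr1 mul_polyC.
Qed.

Lemma homog_coef d p j : (j <= d)%N -> (homog d p)`_j = p`_(d - j) *: 'X^(d - j).
Proof.
move=> le_jd; have lt_jd : (d - j < d.+1)%N by lia.
rewrite /homog coef_sum (bigD1 (Ordinal lt_jd)) //= big1 => [|i ne_i].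
  rewrite /scal /lambda /mu -polyC_exp addr0 mulrA -polyCM coefCM coefXn subKn // eqxx.
  by rewrite mulr1 mul_polyC.
rewrite /scal /lambda /mu -polyC_exp mulrA -polyCM coefCM coefXn.
case: eqP => [e|]; last by rewrite mulr0.
by case/eqP: ne_i; apply: val_inj => /=; case: i e => i /= lt_i e; lia.
Qed.

Variables (n : nat) (A B : 'M[K]_n).

Lemma affine_pencilE i j : affine_pencil A B i j = (A i j)%:P + 'X * (B i j)%:P.
Proof. by rewrite !mxE. Qed.

Lemma size_affine_pencil i j : (size (affine_pencil A B i j) <= 2)%N.
Proof.
rewrite affine_pencilE addrC mulrC mul_polyC.
apply: leq_trans (size_polyD _ _) _; rewrite geq_max.
by rewrite (leq_trans (size_scale_leq _ _)) ?size_polyX // (leq_trans (size_polyC_leq1 _)).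
Qed.

Lemma pencil_homog i j : pencil A B i j = homog 1 (affine_pencil A B i j).
Proof.
rewrite affine_pencilE homogD mulrC mul_polyC -[(A i j)%:P]mulr1 mul_polyC !homogZ.
rewrite -(expr0 'X) homogXn // (_ : homog 1 'X = lambda); first by rewrite !mxE; ring.
by rewrite -[in LHS](expr1 'X) homogXn // mulr1.
Qed.

Lemma det_mxsub_pencil m (f g : 'I_m -> 'I_n) :
  let q := \det (mxsub f g (affine_pencil A B)) in
  (size q <= m.+1)%N /\ \det (mxsub f g (pencil A B)) = homog m q.
Proof.
move=> q; have prodP s := @homog_prod _ (index_enum 'I_m)
  (fun i => affine_pencil A B (f i) (g (s i))) (fun i => size_affine_pencil _ _).
have sz : size (index_enum 'I_m) = m by rewrite /index_enum -enumT size_enum_ord.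
rewrite sz in prodP.
have sgnE (s : 'S_m) (p : {poly K}) : (-1) ^+ s * p = (-1) ^+ s *: p.
  by rewrite -mul_polyC rmorphXn /= polyCN.
have qE : q = \sum_(s : 'S_m) (-1) ^+ s *: \prod_i affine_pencil A B (f i) (g (s i)).
  apply: eq_bigr => s _; rewrite -sgnE; congr (_ * _).
  by apply: eq_bigr => i _; rewrite mxE.
split.
  rewrite qE; apply: (leq_trans (size_sum _ _ _)); apply/bigmax_leqP => s _.
  by apply: leq_trans (size_scale_leq _ _) _; case: (prodP s).
rewrite qE homog_sum; apply: eq_bigr => s _; rewrite homogZ.
rewrite /scal !rmorphXn /= !polyCN !polyC1; congr (_ * _); case: (prodP s) => _ ->.
by apply: eq_bigr => i _; rewrite mxE pencil_homog.
Qed.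

(** Minors of the pencil and of its restriction to the affine line [mu = 1]
    determine each other, because the former are homogeneous of known degree. *)
Lemma pencil_minor m (p : {poly {poly K}}) :
  is_minor (pencil A B) m p <->
    exists q, [/\ is_minor (affine_pencil A B) m q, (size q <= m.+1)%N & p = homog m q].
Proof.
split=> [[f [g [hf hg ->]]]|[q [[f [g [hf hg ->]]] _ ->]]].
  have [le_q ->] := det_mxsub_pencil f g.
  by exists (\det (mxsub f g (affine_pencil A B))); split=> //; exists f, g.
by exists f, g; split=> //; have [_ ->] := det_mxsub_pencil f g.
Qed.

End Homogenization.

Lemma frac_rank_minor (R : idomainType) n (M : 'M[R]_n) m :
  (m <= frac_rank M)%N <-> exists2 p, is_minor M m p & p != 0.
Proof.
rewrite rank_minor; split=> [[_ /minor_map[p pm ->]]|[p pm p_n0]].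
  by rewrite tofrac_eq0; exists p.
by exists (tofrac p); rewrite ?tofrac_eq0 //; apply/minor_map; exists p.
Qed.

Lemma frac_rank_pencil (K : fieldType) n (A B : 'M[K]_n) :
  frac_rank (pencil A B) = frac_rank (affine_pencil A B).
Proof.
apply/eqP; rewrite eqn_leq; apply/andP; split; apply/frac_rank_minor.
  have /frac_rank_minor[p /pencil_minor[q [qm _ ->]] q_n0] := leqnn (frac_rank (pencil A B)).
  by exists q => //; apply: contraNneq q_n0 => ->; rewrite homog0.
have /frac_rank_minor[q qm q_n0] := leqnn (frac_rank (affine_pencil A B)).
move: (qm) => [f [g [hf hg qE]]]; have [le_q _] := det_mxsub_pencil A B f g.
exists (homog (frac_rank (affine_pencil A B)) q).
  by apply/pencil_minor; exists q; split=> //; rewrite qE.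
apply: contraNneq q_n0 => q0; rewrite -qE in le_q.
by rewrite -(homog_horner1 le_q) q0 horner0.
Qed.

(** * Invariant factors and the rank at a point *)

Section PrimeElements.
Variable R : idomainType.
Implicit Types (a b d p q : R) (f : seq (R * nat)) (n m k : nat).

Lemma divides_refl d : divides d d.
Proof. by exists 1; rewrite mul1r. Qed.

Lemma divides0 d : divides d 0.
Proof. by exists 0; rewrite mul0r. Qed.

Lemma divides_mulr d p q : divides d p -> divides d (q * p).
Proof. by move=> [c ->]; exists (q * c); rewrite mulrA. Qed.

Lemma divides_trans d p q : divides d p -> divides p q -> divides d q.
Proof. by move=> dp [c ->]; apply: divides_mulr. Qed.

Variable pi : R.
Hypothesis pi_prime : prime_elt pi.

Let pi_neq0 : pi != 0. Proof. by case: pi_prime. Qed.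

Lemma prime_ndivides_mul p q :
  ~ divides pi p -> ~ divides pi q -> ~ divides pi (p * q).
Proof. by case: pi_prime => _ _ piM np nq /piM[]. Qed.

Lemma prime_ndivides1 : ~ divides pi 1.
Proof.
case: pi_prime => _ /negP nU _ [c c1]; apply: nU.
by apply/unitrP; exists c; rewrite -c1 mulrC -c1.
Qed.

Lemma prime_divides_exp p k : divides pi (p ^+ k) -> divides pi p.
Proof.
elim: k => [/prime_ndivides1 //|k IHk]; rewrite exprS => pik.
by case: pi_prime => _ _ /(_ _ _ pik)[|/IHk].
Qed.

Lemma prime_divides_prime p : prime_elt p -> divides pi p -> associated p pi.
Proof.
move=> [p_n0 _ pP] [c pE].
have [[d piE]|[d cE]] : divides p c \/ divides p pi.
- by apply: pP; rewrite -pE; apply: divides_refl.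
- case: pi_prime => _ /negP nU _; case: nU; apply/unitrP; exists d.
  have e : d * pi = 1 by apply: (mulIf p_n0); rewrite mul1r {2}pE piE; ring.
  by split; rewrite // mulrC.
exists c => //; apply/unitrP; exists d.
have e : c * d = 1 by apply: (mulIf p_n0); rewrite mul1r {2}pE cE; ring.
by split; rewrite // mulrC.
Qed.

(** A factorization provides the exact power of [pi] dividing [p], which in
    an arbitrary domain need not exist. *)
Lemma prime_factorization_split p f : prime_factorization p f ->
  exists k q, p = pi ^+ k * q /\ ~ divides pi q.
Proof.
move=> [f_prime _ [c c_unit ->]].
have : forall pe, pe \in f -> prime_elt pe.1 by move=> pe /f_prime[].
have c_ndiv : ~ divides pi c.
  move=> [d cE]; case: pi_prime => _ /negP nU _; apply: nU.
  by move: c_unit; rewrite cE unitrM => /andP[].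
elim: f {f_prime} => [|pe f IHf] f_prime.
  by exists 0%N, c; rewrite big_nil mulr1 mul1r.
have [|k [q [cqE q_ndiv]]] := IHf _.
  by move=> pe' pe'f; apply: f_prime; rewrite inE pe'f orbT.
rewrite big_cons mulrCA cqE.
have [pe_div|pe_ndiv] := pselect (divides pi pe.1); last first.
  exists k, (pe.1 ^+ pe.2 * q); split; first by ring.
  by apply: prime_ndivides_mul => // /prime_divides_exp.
have [d d_unit peE] := prime_divides_prime (f_prime _ (mem_head _ _)) pe_div.
rewrite peE exprMn; exists (pe.2 + k)%N, (d ^+ pe.2 * q).
split; first by rewrite exprD; ring.
apply: prime_ndivides_mul => // /prime_divides_exp [e dE].
case: pi_prime => _ /negP nU _; apply: nU.
by move: d_unit; rewrite dE unitrM => /andP[].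
Qed.

(** The primes in a factorization are pairwise not associated, so at most one
    of them is associated to [pi]. *)
Lemma prime_factorization_count p f : prime_factorization p f ->
  count (fun x => `[< divides pi x >]) [seq pe.1 ^+ pe.2 | pe <- f] = `[< divides pi p >].
Proof.
move=> [f_prime f_nassoc [c c_unit ->]].
have c_ndiv : ~ divides pi c.
  move=> [d cE]; case: pi_prime => _ /negP nU _; apply: nU.
  by move: c_unit; rewrite cE unitrM => /andP[].
elim: f f_prime f_nassoc => [|pe f IHf] f_prime f_nassoc.
  by rewrite big_nil mulr1 /=; case: asboolP.
have {}IHf : count (fun x => `[< divides pi x >]) [seq pe.1 ^+ pe.2 | pe <- f] =
    `[< divides pi (c * \prod_(pe <- f) pe.1 ^+ pe.2) >].
  apply: IHf => [pe' pe'f|i j lt_ij]; first by apply: f_prime; rewrite inE pe'f orbT.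
  by apply: (f_nassoc i.+1 j.+1).
have [pe_prime pe2_gt0] := f_prime _ (mem_head _ _).
rewrite big_cons mulrCA /=.
have [pe_div|pe_ndiv] := pselect (divides pi pe.1); last first.
  have pek_ndiv : ~ divides pi (pe.1 ^+ pe.2) by move/prime_divides_exp.
  rewrite asboolF // add0n IHf; congr nat_of_bool.
  apply: asbool_equiv_eq; split=> [/divides_mulr //|].
  by case: pi_prime => _ _ /[apply] -[].
have pek_div : divides pi (pe.1 ^+ pe.2).
  by rewrite -(prednK pe2_gt0) exprSr; apply: divides_mulr.
rewrite !asboolT //; last by rewrite mulrC; apply: divides_mulr.
rewrite (@eq_in_count _ _ pred0) ?count_pred0 // => _ /mapP[pe' pe'f ->].
apply: asboolF => /prime_divides_exp.
have [pe'_prime _] : prime_elt pe'.1 /\ (0 < pe'.2)%N.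
  by apply: f_prime; rewrite inE pe'f orbT.
have [d d_unit peE] := prime_divides_prime pe_prime pe_div.
move/(prime_divides_prime pe'_prime) => [d' d'_unit pe'E].
have lt_idx : (index pe' f < size f)%N by rewrite index_mem.
apply: (f_nassoc 0%N (index pe' f).+1) => //=; rewrite nth_index //.
exists (d / d'); first by rewrite unitrMl ?unitrV.
by rewrite peE pe'E mulrA divrK.
Qed.

End PrimeElements.

Section InvariantFactors.
Variables (R : idomainType) (n : nat) (M : 'M[R]_n) (pi : R).
Hypothesis pi_prime : prime_elt pi.

(** Laplace expansion only shows that [pi ^+ k] divides a minor [det N] of order
    [m + 1].  The identity [det (adj N) = det N ^+ m] gives more: its left-hand side
    is divisible by [pi ^+ (k * (m + 1))], which forces [det N] to be
    divisible by more than [pi ^+ k]. *)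
Lemma minor_divides_exp_step m k : (0 < k)%N ->
    (forall p, is_minor M m p -> divides (pi ^+ k) p) ->
  forall p, is_minor M m.+1 p -> divides (pi ^+ k.+1) p.
Proof.
move=> k_gt0 pik_minor _ [f [g [hf hg ->]]]; set N := mxsub f g M.
have pi_neq0 : pi != 0 by case: pi_prime.
have pik_cofactor i j : divides (pi ^+ k) (cofactor N i j).
  apply: divides_mulr; apply: pik_minor; exists (f \o lift i), (g \o lift j); split.
  - by move=> a b lt_ab; apply: hf; rewrite /= /bump; lia.
  - by move=> a b lt_ab; apply: hg; rewrite /= /bump; lia.
  - by congr (\det _); apply/matrixP => a b; rewrite !mxE.
have [c cE] : exists c : 'I_m.+1 -> 'I_m.+1 -> R,
    forall i j, cofactor N j i = pi ^+ k * c i j.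
  have /choice[c cE] (ij : 'I_m.+1 * 'I_m.+1) :
      exists d, cofactor N ij.2 ij.1 = pi ^+ k * d.
    by have [d dE] := pik_cofactor ij.2 ij.1; exists d; rewrite mulrC.
  by exists (fun i j => c (i, j)) => i j; rewrite (cE (i, j)).
have adjE : \adj N = pi ^+ k *: \matrix_(i, j) c i j.
  by apply/matrixP => i j; rewrite !mxE cE.
have [->|N_neq0] := eqVneq (\det N) 0; first exact: divides0.
have det_adj : \det (\adj N) = \det N ^+ m.
  apply: (mulfI N_neq0); rewrite -det_mulmx mul_mx_adj det_scalar exprS //.
suff pij j : (j <= k.+1)%N -> divides (pi ^+ j) (\det N) by apply: pij.
elim: j => [|j IHj] le_jk; first by exists (\det N); rewrite mulr1.
have [|q qE] := IHj; first exact: ltnW.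
have [d dE] : divides pi (q ^+ m).
  have lt_jk : (j * m < k * m.+1)%N by nia.
  have -> : q ^+ m = pi ^+ (k * m.+1 - j * m) * \det (\matrix_(i, j) c i j).
    apply: (mulIf (expf_neq0 (j * m) pi_neq0)).
    rewrite mulrAC -exprD subnK ?(ltnW lt_jk) //.
    by rewrite !exprM -exprMn -qE -det_adj adjE detZ.
  rewrite -subn_gt0 in lt_jk; rewrite -(prednK lt_jk) exprS -mulrA mulrC.
  exact/divides_mulr/divides_refl.
have [e eE] : divides pi q by apply: (prime_divides_exp pi_prime (k := m)); exists d.
by exists e; rewrite qE eE exprS mulrA.
Qed.

Variables (rho : nat) (s : seq R).
Hypothesis rho_rank : forall m,
  (m <= rho)%N <-> exists2 p, is_minor M m p & ~ divides pi p.
Hypothesis s_invariant : invariant_factors M s.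
Hypothesis s_split : forall m, (m < size s)%N ->
  exists k q, s`_m = pi ^+ k * q /\ ~ divides pi q.

(** Setting [G 0] = 1, the gcd of the minors of order 0, removes the special role
    of the first invariant factor. *)
Lemma invariant_factors_gcd : exists G : nat -> R,
  [/\ G 0%N = 1, forall m, (m <= size s)%N -> is_gcd (is_minor M m) (G m)
    & forall m, (m < size s)%N -> G m.+1 = s`_m * G m].
Proof.
have [_ [G [G_gcd s0 sG]]] := s_invariant.
exists (fun m => if m is 0%N then 1 else G m); split=> // [[|m] lt_m|[|m] lt_m].
- split=> [p _|d]; first by exists p; rewrite mulr1.
  apply; have h (i : 'I_0) : 'I_n by case: i.
  by exists h, h; split=> [[]|[]|] //; rewrite det_mx00.
- exact: G_gcd.
- by rewrite mulr1 -s0.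
- by rewrite -sG.
Qed.

(** If [pi ^+ k] is the exact power of [pi] in [G m], then [pi ^+ k.+1] divides all minors
    of order [m + 1]: for [k > 0] by [minor_divides_exp_step], and for [k = 0] because
    these minors have order larger than the rank at [pi]. *)
Lemma divides_invariant_factor m : (m < size s)%N ->
  divides pi s`_m <-> (rho <= m)%N.
Proof.
have [G [G0 G_gcd sG]] := invariant_factors_gcd; move=> lt_m.
split=> [pis|le_rho].
  rewrite leqNgt; apply/negP => /rho_rank[p pm]; apply.
  have [Gp _] := G_gcd _ lt_m; apply: divides_trans (Gp _ pm).
  by rewrite sG // mulrC; apply: divides_mulr.
have [k [q [GE q_ndiv]]] : exists k q, G m = pi ^+ k * q /\ ~ divides pi q.
  elim: m lt_m {le_rho} => [|m IHm] lt_m.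
    by exists 0%N, 1; rewrite mul1r; split=> //; apply: prime_ndivides1.
  have [|k [q [GE q_ndiv]]] := IHm; first exact: ltnW.
  have [j [t [sE t_ndiv]]] := s_split (ltnW lt_m).
  exists (j + k)%N, (t * q); rewrite (sG _ (ltnW lt_m)) GE sE exprD.
  by split; [ring | apply: prime_ndivides_mul].
have pik_G : divides (pi ^+ k.+1) (G m.+1).
  have [_] := G_gcd _ lt_m; apply.
  case: k GE => [|k] GE.
    move=> p pm; apply: contrapT => p_ndiv.
    have : (m.+1 <= rho)%N by apply/rho_rank; exists p.
    by rewrite ltnNge le_rho.
  apply: minor_divides_exp_step => // p pm; have [Gp _] := G_gcd _ (ltnW lt_m).
  by apply: divides_trans (Gp _ pm); rewrite GE mulrC; apply/divides_mulr/divides_refl.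
have [c] := pik_G; rewrite sG // GE exprSr mulrA => cE.
have : divides pi (s`_m * q).
  exists c; have pik_n0 : pi ^+ k != 0 by rewrite expf_neq0 //; case: pi_prime.
  by apply: (mulIf pik_n0); rewrite mulrAC cE; ring.
by case: pi_prime => _ _ h /h[].
Qed.

End InvariantFactors.

(** Every invariant factor divisible by [pi] contributes one power of [pi] to the
    elementary divisors, and these are the invariant factors past the rank at [pi]. *)
Lemma elementary_divisors_count (R : idomainType) n (M : 'M[R]_n) (pi : R) rho E :
    prime_elt pi ->
    (forall m, (m <= rho)%N <-> exists2 p, is_minor M m p & ~ divides pi p) ->
    elementary_divisors M E ->
  count (fun x => `[< divides pi x >]) E = (frac_rank M - rho)%N.
Proof.
move=> pi_prime rho_rank [s [F [s_inv szF F_fact /seq.permP ->]]].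
have [<- _] := s_inv.
have s_split m : (m < size s)%N -> exists k q, s`_m = pi ^+ k * q /\ ~ divides pi q.
  by move=> lt_m; apply: (prime_factorization_split pi_prime (F_fact _ lt_m)).
have divP m lt_m := @divides_invariant_factor _ _ _ _ pi_prime _ _ rho_rank s_inv s_split m lt_m.
rewrite map_flatten count_flatten -map_comp.
have -> : [seq (count (fun x => `[< divides pi x >]) \o map (fun pe => pe.1 ^+ pe.2)) f | f <- F]
    = [seq nat_of_bool (rho <= m)%N | m <- iota 0 (size s)].
  apply: (@eq_from_nth _ 0%N); rewrite ?size_map ?size_iota // => m lt_m.
  rewrite (nth_map [::]) // (nth_map 0%N) ?size_iota -?szF // nth_iota -?szF // add0n.
  rewrite szF in lt_m.
  rewrite /= (prime_factorization_count pi_prime (F_fact _ lt_m)).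
  by congr nat_of_bool; apply/asboolP/idP; rewrite divP.
rewrite sumnE big_map -{1}[size s]subn0 -/(index_iota 0 (size s)) big_mkcond /=.
elim: (size s) => [|m IHm]; first by rewrite big_nil.
by rewrite big_nat_recr //= IHm; lia.
Qed.

Section Points.
Variables (K : fieldType) (n : nat) (A B : 'M[K]_n).
Local Notation Klm := {poly {poly K}}.

(** A point of the projective line is described by the linear form [pi] that vanishes there
    and a morphism [phi] with kernel [pi] that parametrizes the line through the
    point, so that the pencil becomes ['X] times its value [N]. *)
Section Point.
Variables (pi : Klm) (phi : {rmorphism Klm -> {poly K}}) (N : 'M[K]_n).
Hypothesis phi_ker : forall p, divides pi p <-> phi p = 0.
Hypothesis phi_pencil : map_mx phi (pencil A B) = 'X *: map_mx polyC N.
Hypothesis pi_neq0 : pi != 0.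

Lemma point_prime : prime_elt pi.
Proof.
split=> //.
  apply/negP => /unitrP[q [q_pi _]].
  have /phi_ker/eqP : divides pi 1 by exists q.
  by rewrite rmorph1 oner_eq0.
move=> p q /phi_ker/eqP; rewrite rmorphM mulf_eq0 => /orP[]/eqP; rewrite -phi_ker; tauto.
Qed.

Lemma point_rank m :
  (m <= \rank N)%N <-> exists2 p, is_minor (pencil A B) m p & ~ divides pi p.
Proof.
have phi_minor (f g : 'I_m -> 'I_n) :
    phi (\det (mxsub f g (pencil A B))) = 'X^m * (\det (mxsub f g N))%:P.
  rewrite -det_map_mx map_mxsub phi_pencil -det_map_mx map_mxsub -detZ.
  by congr (\det _); apply/matrixP => i j; rewrite !mxE.
rewrite rank_minor; split=> [[_ [f [g [hf hg ->]]] det_n0]|[_ [f [g [hf hg ->]]] pi_ndiv]].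
  exists (\det (mxsub f g (pencil A B))); first by exists f, g.
  move/phi_ker/eqP; rewrite phi_minor mulf_eq0 polyC_eq0 (negPf det_n0) orbF.
  by rewrite expf_eq0 polyX_eq0 andbF.
exists (\det (mxsub f g N)); first by exists f, g.
by apply/eqP => det0; apply: pi_ndiv; apply/phi_ker; rewrite phi_minor det0 mulr0.
Qed.

Lemma point_rank_leq : (\rank N <= frac_rank (pencil A B))%N.
Proof.
apply/frac_rank_minor; have /point_rank[p pm p_ndiv] := leqnn (\rank N).
by exists p => //; apply/eqP => p0; apply: p_ndiv; rewrite p0; apply: divides0.
Qed.

Lemma point_count E : elementary_divisors (pencil A B) E ->
  (count (fun p => phi p == 0%R) E + \rank N)%N = frac_rank (pencil A B).
Proof.
move/(elementary_divisors_count point_prime point_rank) => EE.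
rewrite -[RHS](subnK point_rank_leq) -EE; congr addn; apply: eq_count => p.
by apply/eqP/asboolP; rewrite phi_ker.
Qed.

End Point.

Lemma divides_mu (p : Klm) : divides mu p <-> horner_eval 0 p = 0.
Proof.
have h := factor_theorem p 0; rewrite subr0 in h.
by split=> [/h/rootP|/rootP/h].
Qed.

Lemma swapXY_linear_prime a :
  swapXY (lambda - mu * scal a) = 'X - (a *: 'X)%:P :> Klm.
Proof.
rewrite rmorphB rmorphM /= /lambda /mu /scal !swapXY_polyC swapXY_X.
by rewrite map_polyX map_polyC /= -polyCM mulrC mul_polyC.
Qed.

Lemma divides_linear_prime a (p : Klm) :
  divides (lambda - mu * scal a) p <-> (horner_eval (a *: 'X) \o swapXY) p = 0.
Proof.
split=> [[q ->]|] /=.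
  rewrite /horner_eval rmorphM /= swapXY_linear_prime hornerM !hornerE subrr mulr0 //.
move/rootP/factor_theorem => [q qE]; exists (swapXY q).
by rewrite -[p]swapXYK qE rmorphM /= -swapXY_linear_prime swapXYK.
Qed.

Variables (es : seq nat) (afs : seq (K * nat)).
Hypothesis es_gt0 : forall e, e \in es -> (0 < e)%N.
Hypothesis afs_gt0 : forall af, af \in afs -> (0 < af.2)%N.
Hypothesis elem_div : elementary_divisors (pencil A B) (paired_divisors es afs).

Lemma count_paired_divisors (P : pred Klm) :
  count P (paired_divisors es afs) =
    (2 * count (fun e => P (mu ^+ e)) es
     + 2 * count (fun af => P ((lambda - mu * scal af.1) ^+ af.2)%R) afs)%N.
Proof.
rewrite /paired_divisors count_cat; congr addn.
  by elim: (es) => //= e s ->; lia.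
by elim: (afs) => //= af s ->; lia.
Qed.

(** The factor 2 accounts for the elementary divisors being listed in pairs. *)
Lemma rank_at_infinity : (2 * size es + \rank B)%N = frac_rank (affine_pencil A B).
Proof.
have phi_pencil : map_mx (horner_eval 0) (pencil A B) = 'X *: map_mx polyC B.
  apply/matrixP => i j; rewrite !mxE /horner_eval /mu /lambda /scal.
  by rewrite !hornerE; ring.
rewrite -frac_rank_pencil -(point_count divides_mu phi_pencil _ elem_div) ?polyX_eq0 //.
congr addn; rewrite count_paired_divisors.
rewrite (@eq_in_count _ _ predT) ?count_predT; last first.
  by move=> e /es_gt0 e_gt0; rewrite /= /horner_eval /mu hornerXn expr0n -(prednK e_gt0) eqxx.
rewrite [X in (_ = _ + 2 * X)%N](@eq_in_count _ _ pred0) ?count_pred0 ?muln0 ?addn0 //.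
move=> af _; rewrite /= /horner_eval /= horner_exp /lambda /mu !hornerE.
by rewrite ?mul0r ?subr0 expf_eq0 ?polyX_eq0 ?andbF.
Qed.

Lemma rank_at a :
  (2 * count (fun af => af.1 == a) afs + \rank (A + a *: B)%R)%N =
    frac_rank (affine_pencil A B).
Proof.
have phi_pencil : map_mx (horner_eval (a *: 'X) \o swapXY) (pencil A B)
    = 'X *: map_mx polyC (A + a *: B).
  apply/matrixP => i j; rewrite !mxE /= /mu /lambda /scal rmorphD !rmorphM /=.
  rewrite !swapXY_polyC swapXY_X !map_polyC /= map_polyX /horner_eval.
  by rewrite !hornerE -scalerAl; rewrite polyCD polyCM -!mul_polyC; ring.
have lin_n0 : lambda - mu * scal a != 0 :> Klm.
  by rewrite -swapXY_eq0 swapXY_linear_prime polyXsubC_eq0.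
rewrite -frac_rank_pencil -(point_count (divides_linear_prime a) phi_pencil lin_n0 elem_div).
congr addn; rewrite count_paired_divisors.
rewrite [X in (_ = 2 * X + _)%N](@eq_in_count _ _ pred0) ?count_pred0 ?muln0 ?add0n; last first.
  move=> e _; rewrite /= rmorphXn /= /mu swapXY_X /horner_eval horner_exp hornerC.
  by rewrite expf_eq0 polyX_eq0 andbF.
congr muln; apply: eq_in_count => af /afs_gt0 af_gt0.
rewrite /= rmorphXn /= swapXY_linear_prime /horner_eval horner_exp !hornerE.
by rewrite expf_eq0 af_gt0 /= -scalerBl scaler_eq0 polyX_eq0 orbF subr_eq0 eq_sym.
Qed.

End Points.

(** * Minimal solutions *)

Lemma fractionP (R : idomainType) (x : {fraction R}) :
  exists2 d : R, d != 0 & exists p, tofrac d * x = tofrac p.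
Proof.
Local Open Scope quotient_scope.
elim/quotW: x => x; exists \d_x; first exact: denom_ratioP.
exists \n_x; unlock tofrac; rewrite -[LHS]FracField.pi_mul.
apply/eqmodP; rewrite /= FracField.equivfE /FracField.mulf.
rewrite !numden_Ratio ?oner_neq0 ?mulf_neq0 ?denom_ratioP ?oner_neq0 //.
by rewrite mulr1 mul1r mulrC.
Qed.

Lemma common_denominator (R : idomainType) m (u : 'rV[{fraction R}]_m) :
  exists2 d : R, d != 0 & exists v : 'rV_m, tofrac d *: u = map_mx (@tofrac R) v.
Proof.
have /choice[d /choice[p dpP]] (i : 'I_m) :
    exists d p, d != 0 /\ tofrac d * u 0 i = tofrac p.
  by have [d d_n0 [p dp]] := fractionP (u 0 i); exists d, p.
exists (\prod_i d i).
  by apply/prodf_neq0 => i _; case: (dpP i).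
exists (\row_i (\prod_(j | j != i) d j * p i)); apply/rowP => i; rewrite !mxE.
rewrite (bigD1 i) //= mulrC [in LHS]rmorphM mulrA -mulrC; case: (dpP i) => _ dp.
by rewrite [u 0 i * _]mulrC dp -rmorphM.
Qed.

Section LinIndep.
Variables (R : nzRingType) (V : lmodType R).
Implicit Types (s : seq V) (c : nat -> R).

Lemma lin_indepP s : lin_indep s <->
  forall c, \sum_(i < size s) c i *: s`_i = 0 -> forall i, (i < size s)%N -> c i = 0.
Proof.
split=> [s_indep c c0 i lt_i|s_indep c c0 i].
  by have := s_indep (fun j : 'I_(size s) => c j) c0 (Ordinal lt_i).
pose c' j := if insub j is Some o then c o else 0.
have c'E (j : 'I_(size s)) : c' j = c j by rewrite /c' valK.
by rewrite -c'E; apply: s_indep => //; apply: etrans c0; apply: eq_bigr => j _; rewrite c'E.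
Qed.

Lemma lin_indep_takeP s j : (j <= size s)%N -> lin_indep (take j s) <->
  forall c, \sum_(i < j) c i *: s`_i = 0 -> forall i, (i < j)%N -> c i = 0.
Proof.
move=> le_j; rewrite lin_indepP size_takel //.
have E c : \sum_(i < j) c i *: (take j s)`_i = \sum_(i < j) c i *: s`_i.
  by apply: eq_bigr => i _; rewrite nth_take.
by split=> h c; [rewrite -E | rewrite E]; apply: h.
Qed.

Lemma lin_indep_rconsP s j w : (j <= size s)%N -> lin_indep (rcons (take j s) w) <->
  forall c, \sum_(i < j) c i *: s`_i + c j *: w = 0 -> forall i, (i <= j)%N -> c i = 0.
Proof.
move=> le_j; rewrite lin_indepP size_rcons size_takel //.
have E c : \sum_(i < j.+1) c i *: (rcons (take j s) w)`_i =
    \sum_(i < j) c i *: s`_i + c j *: w.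
  rewrite big_ord_recr /= nth_rcons size_takel // ltnn eqxx; congr (_ + _).
  by apply: eq_bigr => i _; rewrite nth_rcons size_takel // ltn_ord nth_take.
by split=> h c; [rewrite -E | rewrite E]; apply: h.
Qed.

End LinIndep.

Section MinimalSolutions.
Variables (K : fieldType) (n : nat) (A B : 'M[K]_n).
Local Notation R := {poly K}.
Local Notation M := (affine_pencil A B).
Variable x : seq 'cV[R]_n.
Hypothesis x_min : minimal_solutions A B x.
Local Notation k := (size x).
Local Notation eps j := (vdeg x`_j).

Lemma minimal_solution j : (j < k)%N -> M *m x`_j = 0.
Proof. by case: x_min => xP _ /xP[]. Qed.

Lemma minimal_indep j (c : nat -> R) : (j <= k)%N ->
  \sum_(i < j) c i *: x`_i = 0 -> forall i, (i < j)%N -> c i = 0.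
Proof.
case: j => // j lt_j; have [xP _] := x_min; have [_ + _] := xP j lt_j.
by move/(lin_indep_takeP _) => /(_ lt_j); apply.
Qed.

Lemma size_minimal_solution j i : (size (x`_j i ord0)%R <= (eps j).+1)%N.
Proof.
by rewrite /vdeg; apply: leq_trans (leqSpred _); apply: (@leq_bigmax _ (fun i => size (x`_j i ord0)%R)).
Qed.

(** The form in which minimality of the degrees is used: below, a linear
    dependence between the values at a point, or between the leading coefficients, would yield
    a [w] of too small degree, after division by ['X - a] or by
    cancellation of the leading coefficient. *)
Lemma minimal_solution_degree j (c : nat -> R) (b : R) (w : 'cV[R]_n) d :
    (j < k)%N -> M *m w = 0 -> c j != 0 ->
    \sum_(i < j.+1) c i *: x`_i = b *: w ->
    (forall i, (size (w i ord0) <= d)%N) -> (eps j < d)%N.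
Proof.
move=> lt_j w_sol cj_n0 cE w_deg.
have w_indep (a : nat -> R) : \sum_(i < j) a i *: x`_i + a j *: w = 0 ->
    forall i, (i <= j)%N -> a i = 0.
  move=> a0.
  have aj0 : a j = 0.
    have := @minimal_indep j.+1 (fun i => if (i < j)%N then b * a i + a j * c i else a j * c j) lt_j.
    rewrite big_ord_recr /= ltnn => /(_ _ j (leqnn _)); rewrite ltnn => h.
    apply: (mulIf cj_n0); rewrite mul0r; apply: h.
    have -> : \sum_(i < j) (if (i < j)%N then b * a i + a j * c i else a j * c j) *: x`_i
        = b *: \sum_(i < j) a i *: x`_i + a j *: \sum_(i < j) c i *: x`_i.
      rewrite !scaler_sumr -big_split; apply: eq_bigr => i _ /=.
      by rewrite ltn_ord scalerDl !scalerA.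
    move: cE; rewrite big_ord_recr /= => cE.
    rewrite -addrA -scalerA -scalerDr cE scalerA mulrC -scalerA -scalerDr a0.
    exact: scaler0.
  move=> i; rewrite leq_eqVlt => /orP[/eqP-> //|lt_ij].
  move: a0; rewrite aj0 scale0r addr0 => a0.
  by apply: (minimal_indep (ltnW lt_j) a0).
have [xP _] := x_min; have [_ _ xj_min] := xP j lt_j.
have /xj_min : is_solution A B w by [].
move=> /(_ _)/leq_ltn_trans; apply.
  by apply/(lin_indep_rconsP _ (ltnW lt_j)) => a a0; apply: w_indep.
have d_gt0 : (0 < d)%N.
  rewrite lt0n; apply/eqP => d0; rewrite d0 in w_deg.
  have w0 : w = 0.
    apply/colP => i; rewrite mxE; apply/eqP; rewrite -size_poly_leq0 w_deg //.
  have : \sum_(i < j) (i == j :> nat)%:R *: x`_i + (j == j)%:R *: w = 0.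
    by rewrite w0 scaler0 addr0 big1 // => i _; rewrite ltn_eqF ?scale0r.
  move/(w_indep (fun i => (i == j)%:R))/(_ j (leqnn j))/eqP.
  by rewrite eqxx oner_eq0.
by rewrite /vdeg -(prednK d_gt0) ltnS -!subn1 leq_sub2r //; apply/bigmax_leqP.
Qed.

Lemma minimal_indices_mono i j : (i <= j < k)%N -> (eps i <= eps j)%N.
Proof.
move=> /andP[]; rewrite leq_eqVlt => /orP[/eqP-> //|lt_ij] lt_jk.
have lt_ik := ltn_trans lt_ij lt_jk.
have [xP _] := x_min; have [_ _] := xP i lt_ik; apply; first exact: minimal_solution.
apply/(lin_indep_rconsP _ (ltnW lt_ik)) => a a0.
pose c l := if (l < i)%N then a l else if l == j then a i else 0.
have c0 : \sum_(l < j.+1) c l *: x`_l = 0.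
  rewrite big_ord_recr /= /c ltnNge (ltnW lt_ij) eqxx /=; apply: etrans a0; congr (_ + _).
  rewrite (big_ord_widen_cond j predT (fun l => a l *: x`_l)) ?(ltnW lt_ij) // [RHS]big_mkcond /=.
  apply: eq_bigr => l _; case: ifP => // _.
  by rewrite ltn_eqF ?scale0r.
move=> l; rewrite leq_eqVlt => /orP[/eqP->|lt_li].
  by have := minimal_indep lt_jk c0 (leqnn j.+1); rewrite /c ltnNge (ltnW lt_ij) eqxx.
have /(_ l) := minimal_indep lt_jk c0; rewrite /c lt_li; apply.
by apply: ltn_trans (lt_li) _; apply: leqW.
Qed.

Let last_nonzero (c : nat -> K) : ~ (forall j, (j < k)%N -> c j = 0) ->
  exists j, [/\ (j < k)%N, c j != 0 & forall i, (j < i < k)%N -> c i = 0].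
Proof.
move=> c_n0.
have exP : exists j, (j < k)%N && (c j != 0).
  apply: contrapT => h; apply: c_n0 => j lt_j; apply: contrapT => /eqP cj.
  by apply: h; exists j; rewrite lt_j.
have ubP i : (i < k)%N && (c i != 0) -> (i <= k)%N by case/andP => /ltnW.
case: (ex_maxnP exP ubP) => j /andP[lt_j cj_n0] j_max; exists j; split=> // i /andP[lt_ji lt_ik].
apply/eqP; apply: contraTT lt_ji => ci; rewrite -leqNgt; apply: j_max.
by rewrite lt_ik.
Qed.

Let sum_last (V : zmodType) (F : nat -> V) j : (j < k)%N ->
  (forall i, (j < i < k)%N -> F i = 0) -> \sum_(i < k) F i = \sum_(i < j.+1) F i.
Proof.
move=> lt_j F0; rewrite (big_ord_widen_cond k predT F lt_j) [RHS]big_mkcond /=.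
apply: eq_bigr => i _; case: ltnP => // lt_ji; apply: F0.
by rewrite lt_ji ltn_ord.
Qed.

Lemma minimal_solutions_at (a : K) (c : nat -> K) :
    (forall i, \sum_(j < k) c j * (x`_j i ord0).[a] = 0) ->
  forall j, (j < k)%N -> c j = 0.
Proof.
move=> c0; apply: contrapT => /last_nonzero[j [lt_j cj_n0 j_last]].
pose y := \sum_(l < j.+1) (c l)%:P *: x`_l.
have yE i : y i ord0 = \sum_(l < j.+1) (c l)%:P * x`_l i ord0.
  by rewrite summxE; apply: eq_bigr => l _; rewrite mxE.
have ya i : root (y i ord0) a.
  rewrite /root yE horner_sum; apply/eqP; apply: etrans (c0 i); rewrite (@sum_last _ (fun l => c l * (x`_l i ord0).[a]) j) //.
    by apply: eq_bigr => l _; rewrite hornerM hornerC.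
  by move=> l /j_last->; rewrite mul0r.
pose w := \col_i (y i ord0 %/ ('X - a%:P)) : 'cV[R]_n.
have wE : y = ('X - a%:P) *: w.
  apply/colP => i; rewrite !mxE mulrC divpK //.
  by rewrite dvdp_XsubCl ya.
have y_sol : M *m y = 0.
  rewrite mulmx_sumr big1 // => l _; rewrite -scalemxAr minimal_solution ?scaler0 //.
  by apply: leq_trans (ltn_ord l) lt_j.
have w_sol : M *m w = 0.
  move: y_sol; rewrite wE -scalemxAr => /eqP.
  by rewrite scalemx_eq0 polyXsubC_eq0 => /eqP.
have : (eps j < eps j)%N; last by rewrite ltnn.
apply: (@minimal_solution_degree j (fun l => (c l)%:P) ('X - a%:P) w) => //.
  by rewrite polyC_eq0.
move=> i; rewrite mxE size_divp ?polyXsubC_eq0 // size_XsubC /= leq_subLR add1n.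
rewrite yE; apply: leq_trans (size_sum _ _ _) _; apply/bigmax_leqP => l _.
rewrite mul_polyC; apply: leq_trans (size_scale_leq _ _) _.
by apply: leq_trans (size_minimal_solution _ _) _; rewrite ltnS minimal_indices_mono // -ltnS ltn_ord.
Qed.

Lemma minimal_solutions_leading (c : nat -> K) :
    (forall i, \sum_(j < k) c j * (x`_j i ord0)`_(eps j) = 0) ->
  forall j, (j < k)%N -> c j = 0.
Proof.
move=> c0; apply: contrapT => /last_nonzero[j [lt_j cj_n0 j_last]].
pose b l : R := c l *: 'X^(eps j - eps l).
pose w := \sum_(l < j.+1) b l *: x`_l.
have wE i : w i ord0 = \sum_(l < j.+1) b l * x`_l i ord0.
  by rewrite summxE; apply: eq_bigr => l _; rewrite mxE.
have le_eps (l : 'I_j.+1) : (eps l <= eps j)%N.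
  by rewrite minimal_indices_mono // lt_j -ltnS ltn_ord.
have : (eps j < eps j)%N; last by rewrite ltnn.
apply: (@minimal_solution_degree j b 1 w) => //.
- rewrite mulmx_sumr big1 // => l _; rewrite -scalemxAr minimal_solution ?scaler0 //.
  by apply: leq_trans (ltn_ord l) lt_j.
- by rewrite /b subnn expr0 scaler_eq0 oner_eq0 orbF.
- by rewrite scale1r.
move=> i; apply/leq_sizeP => d; rewrite leq_eqVlt wE coef_sum => /orP[/eqP<-|lt_d].
  apply: etrans (c0 i); rewrite (@sum_last _ (fun l => c l * (x`_l i ord0)`_(eps l)) j) //.
    apply: eq_bigr => l _; rewrite /b -scalerAl coefZ coefXnM ltnNge leq_subr /=.
    by rewrite subKn ?le_eps.
  by move=> l /j_last->; rewrite mul0r.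
rewrite big1 // => l _; rewrite /b -scalerAl coefZ coefXnM; case: ifP => _; rewrite ?mulr0 //.
rewrite nth_default ?mulr0 //; apply: leq_trans (size_minimal_solution _ _) _.
by have := le_eps l; lia.
Qed.

Definition solution_mx : 'M[R]_(n, k) := \matrix_(i, j) x`_j i ord0.
Local Notation Z := solution_mx.

Lemma solution_mxE (c : 'cV[R]_k) (d : nat -> R) :
  (forall j : 'I_k, d j = c j ord0) -> Z *m c = \sum_(j < k) d j *: x`_j.
Proof.
move=> dE; apply/colP => i; rewrite mxE summxE; apply: eq_bigr => j _.
by rewrite !mxE dE mulrC.
Qed.

Lemma mul_pencil_solution_mx : M *m Z = 0.
Proof.
apply/matrixP => i j; rewrite mxE [RHS]mxE.
have := congr1 (fun v : 'cV_n => v i ord0) (minimal_solution (ltn_ord j)).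
by rewrite mxE mxE => h; apply: etrans h; apply: eq_bigr => l _; rewrite [Z _ _]mxE.
Qed.

(** By maximality, clearing denominators shows that the minimal solutions
    span the kernel over the field of fractions. *)
Lemma frac_rank_minimal_solutions : (frac_rank M + k)%N = n.
Proof.
pose F := {fraction R}; pose MF : 'M[F]_n := map_mx (@tofrac R) M.
pose ZF : 'M[F]_(n, k) := map_mx (@tofrac R) Z.
have ZF_free : row_free ZF^T.
  apply: inj_row_free => u uZ0.
  have [d d_n0 [v dvE]] := common_denominator u.
  suff v0 : v = 0.
    move: dvE; rewrite v0 map_mx0 => /eqP; rewrite scalemx_eq0 tofrac_eq0 (negPf d_n0).
    by move/eqP.
  have vZ0 : v *m Z^T = 0.
    have : map_mx (@tofrac R) (v *m Z^T) = 0.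
      by rewrite map_mxM -dvE /= -scalemxAl -map_trmx uZ0 scaler0.
    move/matrixP => h; apply/matrixP => i j; have /eqP := h i j.
    by rewrite [in X in X == _]mxE [in X in _ == X]mxE tofrac_eq0 => /eqP->; rewrite mxE.
  have {}vZ0 : Z *m v^T = 0 by rewrite -[Z]trmxK -trmx_mul vZ0 trmx0.
  pose c j := if insub j is Some o then v 0 o else 0.
  have cE (j : 'I_k) : c j = v^T j ord0 by rewrite /c valK mxE.
  rewrite (solution_mxE cE) in vZ0.
  by apply/rowP => j; have := minimal_indep (leqnn k) vZ0 (ltn_ord j); rewrite cE !mxE.
have MZ : ZF^T *m MF^T = 0.
  by rewrite -trmx_mul -map_mxM mul_pencil_solution_mx map_mx0 trmx0.
have ZF_ker : (kermx MF^T <= ZF^T)%MS.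
  apply/row_subP => i; set u := row i _.
  have uM : u *m MF^T = 0 by apply/sub_kermxP/row_sub.
  have [d d_n0 [v dvE]] := common_denominator u.
  have v_sol : is_solution A B v^T.
    rewrite /is_solution -[LHS]trmxK trmx_mul trmxK.
    have : map_mx (@tofrac R) (v *m M^T) = 0.
      by rewrite map_mxM -dvE /= -scalemxAl -map_trmx uM scaler0.
    move/matrixP => h; apply/matrixP => a b; have /eqP := h b a.
    by rewrite [in X in X == _]mxE [in X in _ == X]mxE tofrac_eq0 => /eqP h'; rewrite mxE h' mxE.
  have [_ /(_ _ v_sol) v_dep] := x_min.
  have [c cP] : exists c : nat -> R, \sum_(i < k) c i *: x`_i + c k *: v^T = 0 /\ ~ (forall i, (i <= k)%N -> c i = 0).
    apply: contrapT => h; apply: v_dep; rewrite -[x in rcons x _]take_size.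
    apply/(lin_indep_rconsP _ (leqnn k)) => c c0; apply: contrapT => c_n0.
    by apply: h; exists c.
  case: cP => cE c_n0.
  have ck_n0 : c k != 0.
    apply/eqP => ck0; apply: c_n0 => j; rewrite leq_eqVlt => /orP[/eqP-> //|lt_j].
    by move: cE; rewrite ck0 scale0r addr0 => cE; apply: (minimal_indep (leqnn k) cE).
  have -> : u = (- (tofrac (c k * d))^-1) *: (map_mx (@tofrac R) (\row_(j < k) c j) *m ZF^T).
    have cZ : (\row_(j < k) c j) *m Z^T = - (c k *: v).
      apply: trmx_inj; rewrite trmx_mul trmxK (@solution_mxE _ c); last by move=> j; rewrite !mxE.
      by apply/eqP; rewrite linearN linearZ /= -addr_eq0 cE.
    rewrite /ZF map_trmx -map_mxM cZ map_mxN /= map_mxZ /= scalerN scaleNr opprK -dvE !scalerA.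
    rewrite -tofracM mulVf ?scale1r //.
    by rewrite tofrac_eq0 mulf_neq0.
  by rewrite scalemx_sub // submxMl.
have : \rank (kermx MF^T) = k.
  apply/eqP; rewrite eqn_leq; apply/andP; split.
    by rewrite (leq_trans (mxrankS ZF_ker)) // rank_leq_row.
  by rewrite -{1}(eqP ZF_free) mxrankS // sub_kermx MZ.
rewrite mxrank_ker mxrank_tr -/(frac_rank M) => <-.
by rewrite subnKC // rank_leq_row.
Qed.

End MinimalSolutions.

(** * Bases of the kernel and minors of the pencil *)

(** Ideals are given by predicates, which lets each use supply the ideal that
    consists of the multipliers for which some equation becomes solvable. *)
Lemma ideal_one (K : closedFieldType) (J : {poly K} -> Prop) :
    (forall p q, J p -> J q -> J (p + q)) -> (forall p q, J q -> J (p * q)) ->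
    (forall a, exists2 p, J p & p.[a] != 0) ->
  J 1.
Proof.
move=> JD JM J_noroot.
have exJ : exists d, `[< exists2 p, J p & p != 0 /\ size p = d >].
  have [p Jp p_n0] := J_noroot 0; exists (size p); apply/asboolP; exists p => //.
  by split=> //; apply: contraNneq p_n0 => ->; rewrite horner0.
case: (ex_minnP exJ) => d /asboolP[p Jp [p_n0 szp]] d_min.
have [/size_poly1P[c c_n0 pE]|/closed_rootP[a pa]] := boolP (size p == 1%N).
  have -> : 1 = c^-1%:P * p by rewrite pE -polyCM mulVf.
  exact: JM.
have [q Jq qa] := J_noroot a.
have Jqp : J (q %% p).
  by rewrite -[q %% p](addKr (q %/ p * p)) -divp_eq addrC -mulNr; apply: JD => //; apply: JM.
have [qp0|qp_n0] := eqVneq (q %% p) 0; last first.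
  have := d_min (size (q %% p)); rewrite leqNgt -szp ltn_modp p_n0 => h.
  by suff: false by []; apply: h; apply/asboolP; exists (q %% p).
have p_dvd_q : p %| q by apply/eqP.
have := dvdp_trans (_ : 'X - a%:P %| p) p_dvd_q.
by rewrite !dvdp_XsubCl => /(_ pa) /rootP qa0; rewrite qa0 eqxx in qa.
Qed.

Lemma col_free_complement (F : fieldType) r k (Z : 'M[F]_(r + k, k)) :
    (forall c : 'cV_k, Z *m c = 0 -> c = 0) ->
  exists Y : 'M_(r + k, r), row_mx Y Z \in unitmx.
Proof.
move=> Z_free.
have ZT_free : row_free Z^T.
  apply: inj_row_free => u uZ; apply: trmx_inj; rewrite trmx0; apply: Z_free.
  by apply: trmx_inj; rewrite trmx_mul trmxK uZ trmx0.
have rankC : \rank (Z^T)^C%MS = r by rewrite mxrank_compl (eqP ZT_free) addnK.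
have row_base_of m p q (C : 'M[F]_(m, p)) : \rank C = q -> exists Y : 'M_(q, p), (Y :=: C)%MS.
  by move=> <-; exists (row_base C); apply: eq_row_base.
have [Y YE] := row_base_of _ _ _ _ rankC.
exists Y^T; rewrite -unitmx_tr tr_row_mx trmxK -row_full_unit -sub1mx -addsmxE.
by rewrite addsmxC (adds_eqmx (eqmx_refl _) YE) sub1mx addsmx_compl_full.
Qed.

Lemma col_free_left_inverse (F : fieldType) n k (Z : 'M[F]_(n, k)) :
    (forall c : 'cV_k, Z *m c = 0 -> c = 0) -> exists W : 'M_(k, n), W *m Z = 1%:M.
Proof.
move=> Z_free.
have : row_free Z^T.
  apply: inj_row_free => u uZ; apply: trmx_inj; rewrite trmx0; apply: Z_free.
  by apply: trmx_inj; rewrite trmx_mul trmxK uZ trmx0.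
case/row_freeP => W WE; exists W^T.
by apply: trmx_inj; rewrite trmx_mul trmxK WE trmx1.
Qed.

Lemma det_col_degrees (R : comNzRingType) m (P : 'M[{poly R}]_m) (d : 'I_m -> nat) :
    (forall i j, size (P i j) <= (d j).+1)%N ->
  (size (\det P) <= (\sum_j d j).+1)%N /\
  (\det P)`_(\sum_j d j)%N = \det (\matrix_(i, j) (P i j)`_(d j)).
Proof.
move=> P_deg.
have prodP (s : seq 'I_m) (Q : 'I_m -> {poly R}) : (forall j, size (Q j) <= (d j).+1)%N ->
    (size (\prod_(j <- s) Q j)%R <= (\sum_(j <- s) d j).+1)%N /\
    (\prod_(j <- s) Q j)`_(\sum_(j <- s) d j)%N = \prod_(j <- s) (Q j)`_(d j).
  move=> Q_deg; elim: s => [|j s [le_s coef_s]].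
    by rewrite !big_nil size_poly1 coef1.
  rewrite !big_cons; split.
    have := size_polyMleq (Q j) (\prod_(j <- s) Q j).
    by have := Q_deg j; lia.
  rewrite coefM (bigD1 (inord (d j))) //= inordK ?addKn; last by lia.
  rewrite coef_s [X in _ + X]big1 ?addr0 // => i ne_i.
  have [lt_i|lt_i|eq_i] := ltngtP i (d j).
  - rewrite [X in _ * X]nth_default ?mulr0 //; apply: leq_trans le_s _; lia.
  - by rewrite nth_default ?mul0r //; apply: leq_trans (Q_deg j) _.
  - by case/eqP: ne_i; apply: val_inj; rewrite /= inordK //; lia.
have sgnE (s : 'S_m) (p : {poly R}) : (-1) ^+ s * p = (-1) ^+ s *: p.
  by rewrite -mul_polyC rmorphXn /= polyCN.
rewrite -det_tr; split.
  apply: leq_trans (size_sum _ _ _) _; apply/bigmax_leqP => s _.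
  rewrite sgnE; apply: leq_trans (size_scale_leq _ _) _.
  have [|//] := prodP (index_enum 'I_m) (fun j => P^T j (s j)).
  by move=> j; rewrite mxE.
rewrite -[in RHS]det_tr coef_sum; apply: eq_bigr => s _.
rewrite sgnE coefZ; congr (_ * _).
have [|_ ->] := prodP (index_enum 'I_m) (fun j => P^T j (s j)).
  by move=> j; rewrite mxE.
by apply: eq_bigr => j _; rewrite !mxE.
Qed.

(** Both sides come from the product of [col_mx N W] with [row_mx Y Z], resp. with [row_mx Y' Z],
    which is block triangular: the maximal minors of [N] are proportional to
    the complementary minors of its kernel [Z]. *)
Lemma det_mul_kernel (R : idomainType) r k (N : 'M[R]_(r, r + k)) (Z : 'M_(r + k, k))
    (W : 'M_(k, r + k)) (Y Y' : 'M_(r + k, r)) :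
    N *m Z = 0 -> \det (W *m Z) != 0 ->
  \det (N *m Y) * \det (row_mx Y' Z) = \det (N *m Y') * \det (row_mx Y Z).
Proof.
move=> NZ WZ_n0.
have E (T : 'M_(r + k, r)) : \det (col_mx N W) * \det (row_mx T Z) = \det (N *m T) * \det (W *m Z).
  by rewrite -det_mulmx mul_col_row NZ det_lblock.
apply: (mulfI WZ_n0).
by rewrite mulrA [_ * \det (N *m Y)]mulrC -E mulrAC E mulrAC; ring.
Qed.

Section KernelBasis.
Variables (K : closedFieldType) (r k : nat).
Local Notation R := {poly K}.
Local Notation n := (r + k)%N.
Variables (M : 'M[R]_n) (Z : 'M[R]_(n, k)) (eps : 'I_k -> nat).
Hypothesis M_skew : M^T = - M.
Hypothesis MZ : M *m Z = 0.
Hypothesis Z_free : forall a (c : 'cV[K]_k), map_mx (horner_eval a) Z *m c = 0 -> c = 0.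
Hypothesis Z_deg : forall i j, (size (Z i j) <= (eps j).+1)%N.
Hypothesis Z_lead : forall c : 'cV[K]_k, (\matrix_(i, j) (Z i j)`_(eps j)) *m c = 0 -> c = 0.

(** [theta Y] stands for the minor of [Z] complementary to the rows picked by [Y]; general
    constant matrices avoid the signs of complementary minors. *)
Let theta (Y : 'M[K]_(n, r)) : R := \det (row_mx (map_mx polyC Y) Z).
Let minor (X : 'M[K]_(r, n)) (Y : 'M[K]_(n, r)) : R :=
  \det (map_mx polyC X *m M *m map_mx polyC Y).

Let map_polyCK (a : K) m p (X : 'M[K]_(m, p)) : map_mx (horner_eval a) (map_mx polyC X) = X.
Proof. by apply/matrixP => i j; rewrite !mxE /horner_eval hornerC. Qed.

Let theta_nonroot a : exists Y, (theta Y).[a] != 0.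
Proof.
have [Y Y_unit] := col_free_complement (@Z_free a); exists Y.
rewrite -/(horner_eval a _) -det_map_mx map_row_mx map_polyCK -unitfE -unitmxE //.
Qed.

Let W_exists : exists W : 'M[R]_(k, n), \det (W *m Z) != 0.
Proof.
have [W WE] := col_free_left_inverse (@Z_free 0); exists (map_mx polyC W).
have : (\det (map_mx polyC W *m Z)).[0] != 0.
  by rewrite -/(horner_eval 0 _) -det_map_mx map_mxM map_polyCK WE det1 oner_neq0.
by apply: contraNneq => ->; rewrite horner0.
Qed.

Let minor_exchange X Y X' Y' :
  minor X Y * (theta X'^T * theta Y') = minor X' Y' * (theta X^T * theta Y).
Proof.
have [W W_n0] := W_exists.
have right T : minor T Y * theta Y' = minor T Y' * theta Y.
  by apply: (det_mul_kernel (W := W)) => //; rewrite -mulmxA MZ mulmx0.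
have left T : minor X T * theta X'^T = minor X' T * theta X^T.
  have minorE V : minor V T = \det ((map_mx polyC T)^T *m M^T *m map_mx polyC V^T).
    by rewrite /minor -det_tr !trmx_mul -!map_trmx mulmxA.
  rewrite !minorE; apply: (det_mul_kernel (W := W)) => //.
  by rewrite M_skew mulmxN mulNmx -mulmxA MZ mulmx0 oppr0.
by rewrite mulrA left mulrAC right; ring.
Qed.

(** [minor X Y] is a multiple of [theta X^T * theta Y], and the factor does not depend
    on [X] and [Y]: proportionality gives this up to a denominator [theta Y * theta Y],
    and these denominators have no common root. *)
Lemma minors_factor : exists h : R,
  (forall X Y, minor X Y = h * (theta X^T * theta Y)) /\
  (forall g, (forall X Y, g %| minor X Y) -> g %| h).
Proof.
pose J p := exists h : R, (forall X Y, p * minor X Y = h * (theta X^T * theta Y)) /\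
  (forall g, (forall X Y, g %| minor X Y) -> g %| h).
have [h [hE h_dvd]] : J 1.
  apply: ideal_one => [p q [h [hE h_dvd]] [h' [hE' h_dvd']]|p q [h [hE h_dvd]]|a].
  - exists (h + h'); split=> [X Y|g gP]; first by rewrite !mulrDl hE hE'.
    by rewrite dvdp_add ?h_dvd ?h_dvd'.
  - exists (p * h); split=> [X Y|g gP]; first by rewrite -!mulrA hE.
    by rewrite dvdp_mull ?h_dvd.
  have [Y Ya] := theta_nonroot a; exists (theta Y * theta Y); last first.
    by rewrite hornerM mulf_neq0.
  exists (minor Y^T Y); split=> [X T|g gP //].
  by rewrite -minor_exchange trmxK mulrC.
by exists h; split=> // X Y; rewrite -hE mul1r.
Qed.

Lemma size_theta Y : (size (theta Y) <= (\sum_j eps j).+1)%N /\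
  (theta Y)`_(\sum_j eps j)%N = \det (row_mx Y (\matrix_(i, j) (Z i j)`_(eps j))).
Proof.
pose d (j : 'I_n) := if split j is inr j' then eps j' else 0%N.
have dE : (\sum_j d j = \sum_j eps j)%N.
  rewrite big_split_ord /= big1 ?add0n => [|j _].
    by apply: eq_bigr => j _; rewrite /d (unsplitK (inr _ j)).
  by rewrite /d (unsplitK (inl _ j)).
have [|le_d coef_d] := @det_col_degrees K n (row_mx (map_mx polyC Y) Z) d.
  move=> i j; rewrite mxE /d; case: (split j) => j' //.
  by rewrite mxE size_polyC_leq1.
rewrite -dE; split=> //; rewrite coef_d; congr (\det _).
apply/matrixP => i j; rewrite !mxE /d; case: (split j) => j'; rewrite !mxE ?coefC //.
Qed.

Lemma theta_degree : exists Y, size (theta Y) = (\sum_j eps j).+1.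
Proof.
have [Y Y_unit] := col_free_complement Z_lead; exists Y.
have [le_Y coefY] := size_theta Y.
apply/eqP; rewrite eqn_leq le_Y ltnNge; apply/negP => /leq_sizeP/(_ _ (leqnn _)).
by rewrite coefY => /eqP; apply/negP; rewrite -unitfE -unitmxE.
Qed.

(** The multipliers [p] for which [Z] has a left inverse up to [p] form an ideal, and full rank
    of [Z] at a point provides one that does not vanish there. *)
Lemma kernel_basis_left_inverse : exists U : 'M[R]_(k, n), U *m Z = 1%:M.
Proof.
pose J (p : R) := exists U : 'M[R]_(k, n), U *m Z = p%:M.
suff : J 1 by [].
apply: ideal_one => [p q [U UE] [V VE]|p q [U UE]|a].
- by exists (U + V); rewrite mulmxDl UE VE raddfD.
- by exists (p *: U); rewrite -scalemxAl UE scale_scalar_mx.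
have [W WE] := col_free_left_inverse (@Z_free a).
exists (\det (map_mx polyC W *m Z)).
  exists (\adj (map_mx polyC W *m Z) *m map_mx polyC W).
  by rewrite -mulmxA mul_adj_mx.
by rewrite -/(horner_eval a _) -det_map_mx map_mxM map_polyCK WE det1 oner_neq0.
Qed.

End KernelBasis.

(** * Minimal indices and the degrees of the elementary divisors *)

(** The product of all invariant factors telescopes. *)
Lemma elementary_divisors_gcd (R : idomainType) n (M : 'M[R]_n) E :
    elementary_divisors M E ->
  is_gcd (is_minor M (frac_rank M)) (\prod_(p <- E) p).
Proof.
move=> [s [F [s_inv szF F_fact E_perm]]].
have [<- _] := s_inv; have [G [G0 G_gcd sG]] := invariant_factors_gcd s_inv.
have [c c_unit GE] : associated (G (size s)) (\prod_(p <- E) p).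
  rewrite (perm_big _ E_perm) big_map big_flatten /= (big_nth [::]) szF big_mkord.
  suff h m : (m <= size s)%N ->
      associated (G m) (\prod_(i < m) \prod_(pe <- nth [::] F i) pe.1 ^+ pe.2) by apply: h.
  elim: m => [|m IHm] lt_m; first by exists 1; rewrite ?unitr1 // G0 big_ord0 mulr1.
  have [c c_unit GE] := IHm (ltnW lt_m); have [_ _ [d d_unit sE]] := F_fact _ lt_m.
  exists (d * c); first by rewrite unitrM d_unit.
  by rewrite big_ord_recr /= sG // GE sE; ring.
have [Gp G_max] := G_gcd _ (leqnn (size s)); split=> [p /Gp[q ->]|d /G_max[q qE]].
  by exists (q * c); rewrite GE mulrA.
by exists (c^-1 * q); rewrite -mulrA -qE GE mulKr.
Qed.

Section DegreeFormula.
Variables (K : closedFieldType) (r k : nat) (A B : 'M[K]_(r + k)).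
Local Notation R := {poly K}.
Local Notation n := (r + k)%N.
Local Notation M := (affine_pencil A B).
Variables (Z : 'M[R]_(n, k)) (eps : 'I_k -> nat).
Hypothesis M_skew : M^T = - M.
Hypothesis MZ : M *m Z = 0.
Hypothesis Z_free : forall a (c : 'cV[K]_k), map_mx (horner_eval a) Z *m c = 0 -> c = 0.
Hypothesis Z_deg : forall i j, (size (Z i j) <= (eps j).+1)%N.
Hypothesis Z_lead : forall c : 'cV[K]_k, (\matrix_(i, j) (Z i j)`_(eps j)) *m c = 0 -> c = 0.
Hypothesis M_rank : frac_rank M = r.
Variables (es : seq nat) (afs : seq (K * nat)).
Hypothesis elem_div : elementary_divisors (pencil A B) (paired_divisors es afs).

Let e := (2 * \sum_(e <- es) e)%N.
Let f := (2 * \sum_(af <- afs) af.2)%N.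
Let g : R := \prod_(af <- afs) ('X - af.1%:P) ^+ (2 * af.2).

Let homog1 d : homog d 1 = mu ^+ d :> {poly {poly K}}.
Proof. by rewrite -[X in homog d X](expr0 'X) homogXn // expr0 mul1r subn0. Qed.

Let homog_linear (a : K) : homog 1 ('X - a%:P) = lambda - mu * scal a.
Proof.
rewrite homogD -[X in homog 1 X + _](expr1 'X) homogXn // -polyCN -[(- a)%:P]mulr1 mul_polyC homogZ homog1.
by rewrite /scal !polyCN expr1 expr0 mulr1; ring.
Qed.

Let homog_linear_exp (a : K) d : homog d (('X - a%:P) ^+ d) = (lambda - mu * scal a) ^+ d.
Proof.
elim: d => [|d IHd]; first by rewrite !expr0 homog1.
by rewrite !exprS -IHd -add1n homogM ?size_XsubC ?size_exp_XsubC // homog_linear.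
Qed.

Let size_g : size g = f.+1.
Proof.
rewrite /g /f; elim: afs => [|af s IHs]; first by rewrite !big_nil size_poly1.
rewrite !big_cons size_monicM ?monic_exp ?monicXsubC //; last first.
  by rewrite -size_poly_gt0 IHs.
by rewrite IHs size_exp_XsubC; lia.
Qed.

Let g_neq0 : g != 0.
Proof. by rewrite -size_poly_gt0 size_g. Qed.

Let prod_paired : \prod_(p <- paired_divisors es afs) p = homog (e + f) g.
Proof.
rewrite -[g]mul1r homogM ?size_poly1 ?size_g // /paired_divisors big_cat /=; congr (_ * _).
  rewrite homog1 /e; elim: es => [|a s IHs]; first by rewrite !big_nil.
  by rewrite big_flatten /= !big_cons big_nil mulnDr exprD -IHs big_flatten mulr1 mul2n -addnn exprD.
have := size_g; rewrite /g /f; elim: afs => [|af s IHs] sz; first by rewrite !big_nil homog1.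
have sz_s : size (\prod_(af <- s) ('X - af.1%:P) ^+ (2 * af.2)) = (2 * \sum_(af <- s) af.2).+1.
  move: sz; rewrite !big_cons size_monicM ?monic_exp ?monicXsubC //.
    by rewrite size_exp_XsubC addSn /= mulnDr -addnS => /addnI.
  by apply/monic_neq0/monic_prod => *; rewrite monic_exp ?monicXsubC.
rewrite big_flatten /= !big_cons mulnDr homogM ?size_exp_XsubC ?sz_s // -IHs //.
by rewrite big_nil mulr1 homog_linear_exp mul2n -addnn exprD big_flatten.
Qed.

Let gamma_gcd : is_gcd (is_minor (pencil A B) r) (homog (e + f) g).
Proof. by have := elementary_divisors_gcd elem_div; rewrite frac_rank_pencil M_rank prod_paired. Qed.

Let gamma_neq0 : homog (e + f) g != 0.
Proof.
apply: contra_neq g_neq0 => g0; rewrite -[g](@homog_horner1 _ (e + f)).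
  by rewrite g0 horner0.
by rewrite size_g; lia.
Qed.

Let minor_pencil q : is_minor M r q -> (size q <= r.+1)%N /\ is_minor (pencil A B) r (homog r q).
Proof.
move=> [i [j [hi hj ->]]]; have [le_q qE] := det_mxsub_pencil A B i j.
by split=> //; exists i, j; rewrite qE.
Qed.

Let minor_gdvd q : is_minor M r q -> g %| q.
Proof.
case/minor_pencil => le_q /(proj1 gamma_gcd)[c qE].
rewrite -(homog_horner1 le_q) qE hornerM homog_horner1 ?dvdp_mull //.
by rewrite size_g; lia.
Qed.

Let minor_size q : is_minor M r q -> q != 0 -> (e + size q <= r.+1)%N.
Proof.
case/minor_pencil => le_q /(proj1 gamma_gcd)[c qE] q_n0.
rewrite leqNgt; apply/negP => lt_r; have sq_gt0 : (0 < size q)%N by rewrite size_poly_gt0.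
have le_j : (r - (size q).-1 <= r)%N by lia.
have := homog_coef q le_j; rewrite subKn; last by lia.
rewrite qE -[g]mul1r homogM ?size_poly1 ?size_g // homog1 mulrCA mulrC /mu coefMXn.
rewrite (_ : (_ < e)%N = true); last by lia.
move/esym/eqP; rewrite scaler_eq0 expf_eq0 polyX_eq0 andbF orbF.
by rewrite -/(lead_coef q) lead_coef_eq0 (negPf q_n0).
Qed.

(** The gcd property in degree form: no linear factor [l], nor the factor [mu] at infinity
    (the case [l = 1]), can be gained over the product of the elementary divisors. *)
Let minor_gcd (l : R) : size l = 1%N \/ size l = 2%N -> homog 1 l \isn't a GRing.unit ->
    (forall q, is_minor M r q -> q != 0 -> exists2 c, q = g * l * c & (e + f + size c <= r)%N) ->
  False.
Proof.
move=> l_size l_nunit l_fact.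
have l_n0 : l != 0 by rewrite -size_poly_gt0; case: l_size => ->.
have [Gp G_max] := gamma_gcd.
have [p] : divides (homog (e + f) g * homog 1 l) (homog (e + f) g).
  apply: G_max => _ /pencil_minor[q [qm _ ->]].
  have [->|q_n0] := eqVneq q 0; first by rewrite homog0; apply: divides0.
  have [c qE le_r] := l_fact _ qm q_n0.
  have c_gt0 : (0 < size c)%N.
    by rewrite size_poly_gt0; apply: contraNneq q_n0 => c0; rewrite qE c0 mulr0.
  pose m := (r - (e + f + 1))%N; exists (homog m c).
  have rE : r = (e + f + 1 + m)%N by rewrite /m; lia.
  have le_g : (size g <= (e + f).+1)%N by rewrite size_g; lia.
  have le_l : (size l <= 2)%N by case: l_size => ->.
  have le_gl : (size (g * l)%R <= (e + f + 1).+1)%N.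
    by rewrite size_mul // size_g; case: l_size => ->; lia.
  have le_c : (size c <= m.+1)%N by rewrite /m; lia.
  have -> : homog r q = homog (e + f + 1 + m) (g * l * c) by rewrite -rE qE.
  by rewrite !homogM // mulrC.
rewrite mulrCA -{1}[homog _ g]mulr1 => /(mulfI gamma_neq0) /esym pl.
by case/negP: l_nunit; apply/unitrP; exists p; split; rewrite // mulrC.
Qed.

(** In the factorization [h * (theta X^T * theta Y)] of the minors of order [r], the
    factor [h] is their gcd, of degree [f], and [theta] has degree at most the sum of the minimal indices,
    which is attained.  Comparison with the largest degree [r - e] of these minors
    gives the formula. *)
Lemma minimal_indices_degree_formula :
  r = (2 * \sum_j eps j + 2 * \sum_(e <- es) e + 2 * \sum_(af <- afs) af.2)%N.
Proof.
have [h [hE h_gcd]] := minors_factor M_skew MZ Z_free.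
pose theta (Y : 'M[K]_(n, r)) : R := \det (row_mx (map_mx polyC Y) Z).
rewrite -/theta in hE.
have mxsubE (i j : 'I_r -> 'I_n) :
    \det (mxsub i j M) = h * (theta (rowsub i 1%:M)^T * theta (colsub j 1%:M)).
  by rewrite -hE !map_mxsub map_mx1 mxsub_delta.
have g_dvd_h : g %| h.
  apply: h_gcd => X Y; apply: (@minor_closed_det R (fun=> True) (fun p => g %| p)) => //.
    by move=> p q; apply: dvdp_add.
  by move=> a p _; apply: dvdp_mull.
have [c hcE] : exists c, h = c * g by apply/dvdpP.
have [q0 q0m q0_n0] : exists2 q, is_minor M r q & q != 0.
  by apply/frac_rank_minor; rewrite M_rank.
have h_n0 : h != 0.
  case: q0m q0_n0 => [i [j [_ _ ->]]]; rewrite mxsubE; apply: contraNneq => ->.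
  by rewrite mul0r.
have c_n0 : c != 0 by apply: contraNneq h_n0 => c0; rewrite hcE c0 mul0r.
have size_c : size c = 1%N.
  apply/eqP/negP => /negP/closed_rootP[a /factor_theorem[d cE]].
  apply: (@minor_gcd ('X - a%:P)); first by right; rewrite size_XsubC.
    have : prime_elt (lambda - mu * scal a : {poly {poly K}}).
      apply: point_prime (divides_linear_prime a) _.
      by rewrite -swapXY_eq0 swapXY_linear_prime polyXsubC_eq0.
    by rewrite homog_linear => -[].
  move=> q qm q_n0; have := minor_size qm q_n0.
  case: qm q_n0 => [i [j [_ _ ->]]]; rewrite mxsubE => q_n0.
  set t := theta _ * theta _ in q_n0 *; rewrite hcE cE.
  have tE : d * ('X - a%:P) * g * t = g * ('X - a%:P) * (d * t) by ring.
  rewrite tE => le_r; exists (d * t) => //.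
  have dt_n0 : d * t != 0.
    by apply: contraNneq q_n0 => dt0; rewrite hcE cE tE dt0 mulr0.
  have gX_n0 : g * ('X - a%:P) != 0 by rewrite mulf_neq0 ?polyXsubC_eq0.
  have dt_gt0 : (0 < size (d * t)%R)%N by rewrite size_poly_gt0.
  move: le_r; rewrite (size_mul gX_n0 dt_n0) size_mul ?polyXsubC_eq0 // size_g.
  have -> : size ('X - a%:P) = 2%N by exact: size_XsubC.
  by move: dt_gt0; move: (size _) (e) (f) => S e1 f1; lia.
have size_h : size h = f.+1.
  by rewrite hcE size_mul // ?g_neq0 // size_c size_g.
have [Y sizeY] := theta_degree Z_deg Z_lead; rewrite -/(theta Y) in sizeY.
have theta_le := fun Y => proj1 (size_theta Z_deg Y).
have Y_n0 : theta Y != 0 by rewrite -size_poly_gt0 sizeY.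
apply/eqP; rewrite eqn_leq; apply/andP; split.
  rewrite leqNgt; apply/negP => lt_r.
  apply: (@minor_gcd 1); first by left; rewrite size_poly1.
    have : prime_elt (mu : {poly {poly K}}) by apply: (@point_prime _ _ (horner_eval 0)); [exact: divides_mu | rewrite polyX_eq0].
    by rewrite homog1 expr1 => -[].
  move=> q [i [j [_ _ ->]]] _; rewrite mxsubE.
  set Y1 := (rowsub _ _)^T; set Y2 := colsub _ _.
  exists (c * (theta Y1 * theta Y2)); first by rewrite hcE; ring.
  have := theta_le Y1; have := theta_le Y2; have := size_polyMleq (theta Y1) (theta Y2).
  have := size_polyMleq c (theta Y1 * theta Y2); rewrite size_c /theta; lia.
have : (size (h * (theta Y * theta Y))%R <= r.+1 - e)%N.
  rewrite -{1}[Y]trmxK -hE.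
  apply: (@minor_closed_det R (fun a => (size a <= 1)%N) (fun p => (size p <= r.+1 - e)%N)).
  - by rewrite size_poly1.
  - by rewrite size_polyN size_poly1.
  - by move=> a b le_a le_b; apply: leq_trans (size_polyMleq _ _) _; lia.
  - by rewrite size_poly0.
  - by move=> p q le_p le_q; apply: leq_trans (size_polyD _ _) _; rewrite geq_max le_p.
  - by move=> a p le_a le_p; apply: leq_trans (size_polyMleq _ _) _; lia.
  - move=> q qm; have [->|q_n0] := eqVneq q 0; first by rewrite size_poly0.
    by move: (minor_size qm q_n0); move: (size _) (e) => S e1; lia.
  - by move=> i j; rewrite mxE size_polyC_leq1.
  - by move=> i j; rewrite mxE size_polyC_leq1.
rewrite !size_mul ?mulf_neq0 // size_h sizeY /e /f; lia.
Qed.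

End DegreeFormula.

(** * Row vectors of polynomials with values in the row spaces of the pencil *)

Lemma dim_preimage (K : fieldType) (aT rT : vectType K) (f : 'Hom(aT, rT))
    (U : {vspace aT}) (W F : {vspace rT}) : (W <= F)%VS -> (f @: U <= F)%VS ->
  (\dim U + \dim W <= \dim (U :&: f @^-1: W) + \dim F)%N /\
  ((F <= f @: U)%VS -> (\dim U + \dim W = \dim (U :&: f @^-1: W) + \dim F)%N).
Proof.
move=> WF fUF; pose P := (U :&: f @^-1: W)%VS.
have fP : (f @: P = f @: U :&: W)%VS.
  apply/eqP; rewrite eqEsubv subv_cap limgS ?capvSl //=; apply/andP; split.
    apply/subvP => _ /memv_imgP[u + ->]; rewrite memv_cap => /andP[_].
    by rewrite -memv_preim.
  apply/subvP => _ /memv_capP[/memv_imgP[u uU ->] fuW].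
  by rewrite memv_img // memv_cap uU -memv_preim.
have kerP : (P :&: lker f = U :&: lker f)%VS.
  rewrite /P -capvA; congr (_ :&: _)%VS; apply/capv_idPr.
  by rewrite -lpreim0 lpreimS // sub0v.
have := limg_ker_dim f P; rewrite kerP fP -/P => dimP.
have := limg_ker_dim f U => dimU.
have := dimv_sum_cap (f @: U) W => dimI.
have le_sum : (\dim (f @: U + W) <= \dim F)%N by rewrite dimvS // subv_add fUF.
split=> [|F_fU]; first lia.
have -> : F = (f @: U + W)%VS by apply/eqP; rewrite eqEsubv subv_add fUF WF (subv_trans F_fU) ?addvSl.
lia.
Qed.

Section RowSpace.
Variables (K : fieldType) (n : nat).

Definition rowvs m (N : 'M[K]_(m, n)) : {vspace 'rV[K]_n} := limg (linfun (mulmxr N)).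

Lemma mem_rowvs m (N : 'M[K]_(m, n)) u : (u \in rowvs N) = (u <= N)%MS.
Proof.
apply/idP/idP => [/memv_imgP[w _ ->]|/submxP[w ->]]; first by rewrite lfunE /= submxMl.
by apply/memv_imgP; exists w; rewrite ?memvf // lfunE.
Qed.

Lemma rowvsS m p (N : 'M[K]_(m, n)) (N' : 'M_(p, n)) :
  (N <= N')%MS -> (rowvs N <= rowvs N')%VS.
Proof. by move=> sNN'; apply/subvP => u; rewrite !mem_rowvs => /submx_trans; apply. Qed.

Lemma dim_rowvs m (N : 'M[K]_(m, n)) : \dim (rowvs N) = \rank N.
Proof.
have -> : rowvs N = rowvs (row_base N).
  by apply/vspaceP => u; rewrite !mem_rowvs eq_row_base.
rewrite limg_dim_eq ?dimvf /dim /= ?mul1n //.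
apply/eqP; rewrite -subv0; apply/subvP => u; rewrite memv_cap memvf memv_ker lfunE /= memv0.
by rewrite mulmx_free_eq0 ?row_base_free.
Qed.

End RowSpace.

Section VectorPolynomials.
Variables (K : fieldType) (n k : nat).
Local Notation R := {poly K}.
Variables (Z : 'M[R]_(n, k)) (eps : 'I_k -> nat).

(** Coefficient matrices are used for vectors of polynomials of bounded degree because they form a
    finite-dimensional space over the field of constants. *)
Definition pvec d (V : 'M[K]_(n, d)) : 'rV[R]_n := \row_i rVpoly (row i V).

Definition pvec_coef d (v : 'rV[R]_n) : 'M[K]_(n, d) := \matrix_(i, j) (v 0 i)`_j.

Lemma size_pvec d (V : 'M[K]_(n, d)) i : (size (pvec V 0 i)%R <= d)%N.
Proof. by rewrite mxE size_poly. Qed.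

Lemma pvec_coefK d (v : 'rV[R]_n) : (forall i, (size (v 0 i)%R <= d)%N) ->
  pvec (pvec_coef d v) = v.
Proof.
move=> v_deg; apply/rowP => i; rewrite mxE -[RHS](poly_rV_K (v_deg i)).
by congr rVpoly; apply/rowP => j; rewrite !mxE.
Qed.

Lemma coef_pvec d (V : 'M[K]_(n, d)) i (j : 'I_d) : (pvec V 0 i)`_j = V i j.
Proof. by rewrite mxE coef_rVpoly_ord mxE. Qed.

Lemma pvecK d (V : 'M[K]_(n, d)) : pvec_coef d (pvec V) = V.
Proof. by apply/matrixP => i j; rewrite mxE coef_pvec. Qed.

Definition eval_row (a : K) (v : 'rV[R]_n) : 'rV[K]_n := map_mx (horner_eval a) v.
Definition coef_row j (v : 'rV[R]_n) : 'rV[K]_n := \row_i (v 0 i)`_j.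

Definition kernel_coord d j (V : 'M[K]_(n, d.+1)) : 'rV[K]_(d + eps j).+1 :=
  poly_rV ((pvec V *m Z) 0 j).
Definition eval_pvec d (a : K) (V : 'M[K]_(n, d.+1)) : 'rV[K]_n := eval_row a (pvec V).
Definition top_pvec d (V : 'M[K]_(n, d.+1)) : 'rV[K]_n := coef_row d (pvec V).

Lemma pvec_linear d (a : K) (V W : 'M[K]_(n, d)) : pvec (a *: V + W) = a%:P *: pvec V + pvec W.
Proof. by apply/rowP => i; rewrite !mxE !linearP /= mul_polyC. Qed.

Fact kernel_coord_linear d j : linear (@kernel_coord d j).
Proof.
move=> a V W; rewrite /kernel_coord -linearP pvec_linear mulmxDl -scalemxAl.
by congr poly_rV; rewrite mxE [X in X + _]mxE mul_polyC.
Qed.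
HB.instance Definition _ d j := GRing.isLinear.Build K _ _ *:%R _ (@kernel_coord_linear d j).

Fact eval_pvec_linear d a : linear (@eval_pvec d a).
Proof.
move=> c V W; rewrite /eval_pvec pvec_linear; apply/rowP => i.
by rewrite !mxE /horner_eval hornerD hornerM hornerC.
Qed.
HB.instance Definition _ d a := GRing.isLinear.Build K _ _ *:%R _ (@eval_pvec_linear d a).

Fact top_pvec_linear d : linear (@top_pvec d).
Proof.
move=> c V W; rewrite /top_pvec pvec_linear; apply/rowP => i.
by rewrite !mxE coefD coefCM.
Qed.
HB.instance Definition _ d := GRing.isLinear.Build K _ _ *:%R _ (@top_pvec_linear d).

Definition mulXsub_pvec d b (V : 'M[K]_(n, d.+1)) : 'M[K]_(n, d.+2) :=
  pvec_coef d.+2 (('X - b%:P) *: pvec V).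

Fact mulXsub_pvec_linear d b : linear (@mulXsub_pvec d b).
Proof.
move=> a V W; rewrite /mulXsub_pvec pvec_linear; apply/matrixP => i j.
by rewrite !mxE mulrDr coefD mulrCA coefCM.
Qed.
HB.instance Definition _ d b := GRing.isLinear.Build K _ _ *:%R _ (@mulXsub_pvec_linear d b).

Lemma mulXsub_pvecE d b (V : 'M[K]_(n, d.+1)) :
  pvec (mulXsub_pvec b V) = ('X - b%:P) *: pvec V.
Proof.
rewrite pvec_coefK // => i; rewrite mxE; apply: leq_trans (size_polyMleq _ _) _.
by rewrite size_XsubC /= ltnS size_pvec.
Qed.

Hypothesis Z_deg : forall i j, (size (Z i j) <= (eps j).+1)%N.

Lemma size_mul_kernel d (v : 'rV[R]_n) j : (forall i, (size (v 0 i)%R <= d)%N) ->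
  (size ((v *m Z) 0 j)%R <= d + eps j)%N.
Proof.
move=> v_deg; rewrite mxE; apply: leq_trans (size_sum _ _ _) _; apply/bigmax_leqP => i _.
apply: leq_trans (size_polyMleq _ _) _; rewrite -subn1 leq_subLR add1n -addnS.
exact: leq_add.
Qed.

Lemma coef_mul_kernel d (v : 'rV[R]_n) j : (forall i, (size (v ord0 i) <= d.+1)%N) ->
  ((v *m Z) ord0 j)`_(d + eps j) =
    (coef_row d v *m (\matrix_(i, j) (Z i j)`_(eps j))) ord0 j.
Proof.
move=> v_deg; rewrite !mxE coef_sum; apply: eq_bigr => i _.
rewrite !mxE coefM (bigD1 (inord d)) //= inordK ?addKn ?ltnS ?leq_addr //.
rewrite big1 ?addr0 // => l ne_l; have [lt_ld|lt_dl|eq_ld] := ltngtP l d.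
- rewrite [X in _ * X]nth_default ?mulr0 //.
  by apply: leq_trans (Z_deg i j) _; move: lt_ld; move: (l : nat) => m; lia.
- by rewrite nth_default ?mul0r //; apply: leq_trans (v_deg i) _.
by case/eqP: ne_l; apply: val_inj; rewrite /= inordK ?ltnS ?leq_addr.
Qed.

(** An intersection of one condition for each column of [Z], so that the conditions can be
    counted one at a time. *)
Definition annihilator d : {vspace 'M[K]_(n, d.+1)} :=
  (\bigcap_(j < k) lker (linfun (@kernel_coord d j)))%VS.

Let kernel_coord_eq0 d (V : 'M[K]_(n, d.+1)) j :
  (kernel_coord j V == 0) = ((pvec V *m Z) 0 j == 0).
Proof.
have le_d : (size ((pvec V *m Z) 0 j)%R <= (d + eps j).+1)%N.
  by rewrite -addSn; apply: size_mul_kernel; apply: size_pvec.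
apply/eqP/eqP => [V0|V0]; last by rewrite /kernel_coord V0 linear0.
by rewrite -(poly_rV_K le_d) -/(kernel_coord j V) V0 linear0.
Qed.

Lemma mem_annihilator d (V : 'M[K]_(n, d.+1)) : (V \in annihilator d) = (pvec V *m Z == 0).
Proof.
apply/idP/eqP => [VA|V0].
  apply/rowP => j; rewrite [RHS]mxE; apply/eqP; rewrite -kernel_coord_eq0.
  have /subvP/(_ _ VA) : (annihilator d <= lker (linfun (@kernel_coord d j)))%VS.
    by rewrite /annihilator (bigD1 j) //= capvSl.
  by rewrite memv_ker lfunE.
rewrite memvE; apply/subv_bigcapP => j _; rewrite -memvE memv_ker lfunE /=.
by rewrite kernel_coord_eq0 V0 mxE.
Qed.

Lemma dim_annihilator d :
  (n * d.+1 <= \dim (annihilator d) + \sum_j (d + eps j).+1)%N /\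
  ((forall w : 'rV[R]_k, (forall j, (size (w 0 j)%R <= (d + eps j).+1)%N) ->
      exists2 v : 'rV[R]_n, (forall i, (size (v 0 i)%R <= d.+1)%N) & (v *m Z)%R = w) ->
   (n * d.+1 = \dim (annihilator d) + \sum_j (d + eps j).+1)%N).
Proof.
pose S m : {vspace 'M[K]_(n, d.+1)} :=
  (\bigcap_(j < k | (j < m)%N) lker (linfun (@kernel_coord d j)))%VS.
pose E m := (\sum_(j < k | (j < m)%N) (d + eps j).+1)%N.
have SE m (lt_m : (m < k)%N) :
    S m.+1 = (S m :&: linfun (@kernel_coord d (Ordinal lt_m)) @^-1: 0)%VS.
  rewrite /S (bigD1 (Ordinal lt_m)) //= capvC lpreim0; congr (_ :&: _)%VS.
  by apply: eq_bigl => j; rewrite -val_eqE /=; lia.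
have EE m (lt_m : (m < k)%N) : E m.+1 = (E m + (d + eps (Ordinal lt_m)).+1)%N.
  rewrite /E (bigD1 (Ordinal lt_m)) //= addnC; congr addn.
  by apply: eq_bigl => j; rewrite -val_eqE /=; lia.
have Sk : S k = annihilator d by apply: eq_bigl => j; rewrite ltn_ord.
have Ek : E k = (\sum_j (d + eps j).+1)%N by apply: eq_bigl => j; rewrite ltn_ord.
have dim_step m (lt_m : (m < k)%N) := dim_preimage
  (sub0v _ : (0 <= fullv)%VS) (subvf (linfun (@kernel_coord d (Ordinal lt_m)) @: S m)).
have dimF l : \dim (fullv : {vspace 'rV[K]_l}) = l by rewrite dimvf /dim /= mul1n.
have dim0 : (n * d.+1 = \dim (S 0%N) + E 0%N)%N.
  by rewrite /S /E !big_pred0 // dimvf addn0.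
have ind m : (m <= k)%N -> (n * d.+1 <= \dim (S m) + E m)%N.
  elim: m => [_|m IHm lt_m]; first by rewrite dim0.
  have [+ _] := dim_step m lt_m; rewrite -SE dimF dimv0 (EE _ lt_m).
  rewrite addn0 => dimS; apply: leq_trans (IHm (ltnW lt_m)) _.
  by rewrite [(E m + _)%N]addnC addnA leq_add2r.
split=> [|Z_surj]; first by rewrite -Sk -Ek ind.
suff: forall m, (m <= k)%N -> (n * d.+1 = \dim (S m) + E m)%N by rewrite -Sk -Ek; apply.
elim=> // m IHm lt_m; have [_] := dim_step m lt_m.
rewrite -SE dimF dimv0 (EE _ lt_m) IHm ?(ltnW lt_m) // addn0 => ->.
  by rewrite [(E m + _)%N]addnC addnA.
apply/subvP => u _.
pose w : 'rV[R]_k := \row_j (if j == Ordinal lt_m then rVpoly (poly_rV (rVpoly u) : 'rV_(d + eps j).+1) else 0).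
have [|v v_deg vZ] := Z_surj w.
  by move=> j; rewrite mxE; case: ifP => _; rewrite ?size_poly0 ?size_poly.
apply/memv_imgP; exists (pvec_coef d.+1 v).
  rewrite memvE; apply/subv_bigcapP => j lt_jm; rewrite -memvE memv_ker lfunE /=.
  rewrite kernel_coord_eq0 pvec_coefK // vZ mxE -val_eqE /= ifN //.
  by rewrite neq_ltn lt_jm.
by rewrite lfunE /= /kernel_coord pvec_coefK // vZ mxE eqxx !rVpolyK.
Qed.

End VectorPolynomials.

Section LocalConditions.
Variables (K : closedFieldType) (n k : nat) (A B : 'M[K]_n).
Local Notation R := {poly K}.
Local Notation M := (affine_pencil A B).
Variables (Z : 'M[R]_(n, k)) (eps : 'I_k -> nat) (U : 'M[R]_(k, n)).
Hypothesis MZ : M *m Z = 0.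
Hypothesis Z_free : forall a (c : 'cV[K]_k), map_mx (horner_eval a) Z *m c = 0 -> c = 0.
Hypothesis Z_deg : forall i j, (size (Z i j) <= (eps j).+1)%N.
Local Notation L := (\matrix_(i, j) (Z i j)`_(eps j)).
Hypothesis Z_lead : forall c : 'cV[K]_k, L *m c = 0 -> c = 0.
Hypothesis UZ : U *m Z = 1%:M.

Lemma pencil_at_kernel a : (A + a *: B) *m map_mx (horner_eval a) Z = 0.
Proof.
have -> : A + a *: B = map_mx (horner_eval a) M.
  by apply/matrixP => i j; rewrite !mxE /horner_eval !hornerE.
by rewrite -map_mxM MZ map_mx0.
Qed.

Lemma pencil_top_kernel : B *m L = 0.
Proof.
apply/matrixP => i j; rewrite !mxE.
have := congr1 (fun N : 'M[R]_(n, k) => (N i j)`_(eps j).+1) MZ.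
rewrite !mxE coef0 coef_sum => h; apply: etrans h; apply: eq_bigr => l _.
rewrite !mxE mulrDl coefD coefCM -mulrA coefXM /= coefCM.
by rewrite [X in A i l * X]nth_default ?mulr0 ?add0r.
Qed.

Lemma rowvs_sub_kermx (N : 'M[K]_(n, k)) : (forall c : 'cV[K]_k, N *m c = 0 -> c = 0) ->
  forall C : 'M[K]_n, C *m N = 0 ->
    (rowvs C <= rowvs (kermx N))%VS /\ \dim (rowvs (kermx N)) = (n - k)%N.
Proof.
move=> N_free C CN; split; first by apply: rowvsS; apply/sub_kermxP.
have [W WN] := col_free_left_inverse N_free.
rewrite dim_rowvs mxrank_ker; congr subn; apply/eqP; rewrite eqn_leq rank_leq_col /=.
by rewrite -{1}(mxrank1 K k) -WN mxrankM_maxr.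
Qed.

Lemma sub_size_poly (d : nat) (p q : R) :
  (size p <= d)%N -> (size q <= d)%N -> (size (p - q)%R <= d)%N.
Proof.
by move=> hp hq; apply: leq_trans (size_polyD _ _) _; rewrite size_polyN geq_max hp.
Qed.

(** Since the leading coefficients of [Z] are independent, the top coefficient of [w] can be
    cancelled by a multiple of [Z] as long as the degree of [w] exceeds that of [Z]. *)
Lemma kernel_division d (w : 'rV[R]_k) : (forall j, (size (w ord0 j) <= d + eps j)%N) ->
  exists2 v : 'rV[R]_n, forall i, (size (v ord0 i) <= d)%N &
    forall j, (size ((w - v *m Z) ord0 j)%R <= eps j)%N.
Proof.
have [W WL] := col_free_left_inverse Z_lead.
elim: d w => [|d IHd] w w_deg.
  by exists 0 => [i|j]; rewrite ?mul0mx ?subr0 ?mxE ?size_poly0 // w_deg.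
pose a : 'rV[K]_k := \row_j (w ord0 j)`_(d + eps j).
pose c : 'rV[K]_n := a *m W.
have cL : c *m L = a by rewrite /c -mulmxA WL mulmx1.
pose v0 : 'rV[R]_n := \row_i (c ord0 i *: 'X^d).
have v0_deg i : (size (v0 ord0 i) <= d.+1)%N.
  by rewrite mxE; apply: leq_trans (size_scale_leq _ _) _; rewrite size_polyXn.
have v0_coef : coef_row d v0 = c.
  by apply/rowP => i; rewrite !mxE coefZ coefXn eqxx mulr1.
have [|v v_deg wv_deg] := IHd (w - v0 *m Z).
  move=> j; apply/leq_sizeP => l; rewrite leq_eqVlt mxE coefD mxE coefN => /orP[/eqP<-|lt_l].
    by rewrite coef_mul_kernel // v0_coef cL mxE subrr.
  rewrite !nth_default ?subrr //; apply: leq_trans lt_l; rewrite -addSn ?w_deg //.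
  exact: size_mul_kernel.
exists (v0 + v) => [i|j]; last by rewrite mulmxDl opprD addrA.
rewrite mxE; apply: leq_trans (size_polyD _ _) _; rewrite geq_max v0_deg /=.
by rewrite ltnW // ltnS v_deg.
Qed.

Lemma left_inverse_degree : exists D, forall w : 'rV[R]_k,
  (forall j, (size (w ord0 j) <= (eps j).+1)%N) ->
  forall i, (size ((w *m U) ord0 i)%R <= D)%N.
Proof.
exists (\sum_j \sum_i ((eps j).+1 + size (U j i)))%N => w w_deg i.
rewrite mxE; apply: leq_trans (size_sum _ _ _) _; apply/bigmax_leqP => j _.
apply: leq_trans (size_polyMleq _ _) _; apply: leq_trans (leq_pred _) _.
rewrite (bigD1 j) //= (bigD1 i) //= -!addnA.
by apply: leq_trans (leq_add (w_deg j) (leqnn _)) _; rewrite addnA leq_addr.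
Qed.

Lemma kernel_surjective : exists D, forall d, (D <= d)%N -> forall w : 'rV[R]_k,
    (forall j, (size (w ord0 j) <= d + eps j)%N) ->
  exists2 v : 'rV[R]_n, forall i, (size (v ord0 i) <= d)%N & v *m Z = w.
Proof.
have [D U_deg] := left_inverse_degree; exists D => d le_Dd w /kernel_division[v v_deg wv_deg].
exists (v + (w - v *m Z) *m U); last by rewrite mulmxDl -mulmxA UZ mulmx1 addrC subrK.
move=> i; rewrite mxE; apply: leq_trans (size_polyD _ _) _; rewrite geq_max v_deg /=.
by apply: leq_trans le_Dd; apply: U_deg => j; apply: leqW.
Qed.

(** Lagrange interpolation, applied to the projection [u - u Z U] of the constant vector [u]
    to the vectors annihilating [Z]; it does not change the value [u] at [a]. *)
Lemma interpolation : exists D, forall d a (s : seq K) (u : 'rV[K]_n),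
    a \notin s -> (D + size s <= d)%N -> u *m map_mx (horner_eval a) Z = 0 ->
  exists v : 'rV[R]_n, [/\ forall i, (size (v ord0 i) <= d)%N, v *m Z = 0,
    eval_row a v = u & forall b, b \in s -> eval_row b v = 0].
Proof.
have [D U_deg] := left_inverse_degree; exists D.+1 => d a s u a_s le_d uZ.
pose q : R := \prod_(b <- s) ('X - b%:P); pose uP : 'rV[R]_n := map_mx polyC u.
have qa : q.[a] != 0 by rewrite -/(root q a) root_prod_XsubC.
have evP (x : K) : eval_row x uP = u.
  by apply/rowP => i; rewrite !mxE /horner_eval hornerC.
have u_deg i : (size (uP ord0 i) <= 1)%N by rewrite mxE size_polyC_leq1.
pose v0 := uP - uP *m Z *m U.
exists (((q.[a])^-1%:P * q) *: v0); split.
- move=> i; rewrite mxE; apply: leq_trans (size_polyMleq _ _) _.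
  have q_deg : (size ((q.[a])^-1%:P * q)%R <= (size s).+1)%N.
    by rewrite mul_polyC; apply: leq_trans (size_scale_leq _ _) _; rewrite size_prod_XsubC.
  have v0_deg : (size (v0 ord0 i) <= D.+1)%N.
    rewrite mxE [X in _ + X]mxE sub_size_poly // ?(leq_trans (u_deg i)) //.
    apply: leqW; apply: U_deg => j; rewrite -[(eps j).+1]add1n.
    exact: size_mul_kernel.
  rewrite -subn1 leq_subLR; apply: leq_trans (leq_add q_deg v0_deg) _.
  by rewrite addSn add1n ltnS addnC.
- by rewrite -scalemxAl /v0 mulmxBl -[_ *m U *m Z]mulmxA UZ mulmx1 subrr scaler0.
- rewrite /eval_row map_mxZ /= /horner_eval hornerM hornerC mulVf // scale1r.
  by rewrite -/(eval_row a v0) /v0 /eval_row map_mxB !map_mxM -/(eval_row a uP) evP uZ mul0mx subr0.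
move=> b bs; rewrite /eval_row map_mxZ /= /horner_eval hornerM.
by rewrite (rootP (_ : root q b)) ?mulr0 ?scale0r // root_prod_XsubC.
Qed.

Lemma interpolation_at_infinity : exists D, forall d (u : 'rV[K]_n),
    (D <= d)%N -> u *m L = 0 ->
  exists v : 'rV[R]_n, [/\ forall i, (size (v ord0 i) <= d.+1)%N, v *m Z = 0 & coef_row d v = u].
Proof.
have [D Z_surj] := kernel_surjective; exists D => d u le_Dd uL.
pose uX : 'rV[R]_n := \row_i (u ord0 i *: 'X^d).
have uX_deg i : (size (uX ord0 i) <= d.+1)%N.
  by rewrite mxE; apply: leq_trans (size_scale_leq _ _) _; rewrite size_polyXn.
have uX_coef : coef_row d uX = u.
  by apply/rowP => i; rewrite !mxE coefZ coefXn eqxx mulr1.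
have [|v v_deg vZ] := Z_surj d le_Dd (uX *m Z).
  move=> j; apply/leq_sizeP => l; rewrite leq_eqVlt => /orP[/eqP<-|lt_l].
    by rewrite coef_mul_kernel // uX_coef uL mxE.
  apply: (leq_sizeP _ (d.+1 + eps j)%N _); last by rewrite addSn.
  exact: size_mul_kernel.
exists (uX - v); split=> [i||].
- by rewrite mxE [X in _ + X]mxE sub_size_poly // ltnW // ltnS v_deg.
- by rewrite mulmxBl vZ subrr.
apply/rowP => i; rewrite !mxE coefB coefZ coefXn eqxx mulr1.
by rewrite [X in _ - X]nth_default ?subr0.
Qed.

(** The conditions at the points are imposed one after the other, so that [dim_preimage]
    applies to each of them. *)
Definition local_space d (s : seq K) : {vspace 'M[K]_(n, d.+1)} :=
  foldr (fun a V => V :&: linfun (@eval_pvec K n d a) @^-1: rowvs (A + a *: B))%VS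
    (annihilator Z eps d :&: linfun (@top_pvec K n d) @^-1: rowvs B)%VS s.

Lemma local_spaceP d s (V : 'M[K]_(n, d.+1)) : V \in local_space d s <->
  [/\ pvec V *m Z = 0, (top_pvec V <= B)%MS
    & forall a, a \in s -> (eval_pvec a V <= (A + a *: B)%R)%MS].
Proof.
elim: s => [|a s IHs] /=.
  rewrite memv_cap mem_annihilator // -memv_preim lfunE /= mem_rowvs.
  split=> [/andP[/eqP VZ VB]|[-> VB _]]; last by rewrite eqxx.
  by split=> // a; rewrite in_nil.
rewrite memv_cap -memv_preim lfunE /= mem_rowvs; split=> [/andP[/IHs[VZ VB Vs] Va]|[VZ VB Vs]].
  by split=> // b; rewrite inE => /predU1P[->|/Vs].
rewrite (proj2 IHs) ?Vs ?mem_head //.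
by split=> // b bs; apply: Vs; rewrite inE bs orbT.
Qed.

Lemma dim_local_space_geq d s :
  (\dim (annihilator Z eps d) + \rank B + \sum_(a <- s) \rank (A + a *: B)%R <=
   \dim (local_space d s) + (size s).+1 * (n - k))%N.
Proof.
elim: s => [|a s IHs].
  have [BF dimF] := rowvs_sub_kermx Z_lead pencil_top_kernel.
  have [|+ _] := @dim_preimage _ _ _ (linfun (@top_pvec K n d)) (annihilator Z eps d) _ _ BF.
    apply/subvP => _ /memv_imgP[V VA ->]; rewrite lfunE mem_rowvs /=; apply/sub_kermxP.
    move: VA; rewrite mem_annihilator // => /eqP/rowP VZ; apply/rowP => j.
    rewrite /top_pvec -coef_mul_kernel // ?VZ ?mxE ?coef0 // => i.
    exact: size_pvec.
  by rewrite dim_rowvs dimF big_nil /= mul1n addn0.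
have [aF dimF] := rowvs_sub_kermx (@Z_free a) (pencil_at_kernel a).
have [|+ _] := @dim_preimage _ _ _ (linfun (@eval_pvec K n d a)) (local_space d s) _ _ aF.
  apply/subvP => _ /memv_imgP[V /local_spaceP[VZ _ _] ->]; rewrite lfunE mem_rowvs /=; apply/sub_kermxP.
  by rewrite /eval_pvec /eval_row -map_mxM VZ map_mx0.
rewrite dim_rowvs dimF big_cons /= [(_.+2 * _)%N]mulSn => step.
have arith (S P q P' l m x : nat) : (x + S <= P + m -> P + q <= P' + l -> x + (q + S) <= P' + (l + m))%N by lia.
exact: arith IHs step.
Qed.

(** In large degree, interpolation shows that the conditions are independent. *)
Lemma dim_local_space : exists D, forall d s, uniq s -> (D + size s <= d)%N ->
  (n * d.+1 + \rank B + \sum_(a <- s) \rank (A + a *: B)%R =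
   \dim (local_space d s) + \sum_j (d + eps j).+1 + (size s).+1 * (n - k))%N.
Proof.
have [D1 Z_surj] := kernel_surjective; have [D2 interp] := interpolation.
have [D3 interp_oo] := interpolation_at_infinity.
exists (D1 + D2 + D3)%N => d s s_uniq le_d.
have -> : (n * d.+1 = \dim (annihilator Z eps d) + \sum_j (d + eps j).+1)%N.
  apply: (proj2 (dim_annihilator Z_deg d)) => w w_deg.
  by apply: Z_surj => [|j]; [lia | rewrite addSn].
have arith0 (dA rB dP l y : nat) : (dA + rB = dP + l -> dA + y + rB + 0 = dP + y + 1 * l)%N by lia.
have arith (S P q P' l m x y r : nat) :
    (x + y + r + S = P + y + m -> P + q = P' + l -> x + y + r + (q + S) = P' + y + (l + m))%N by lia.
elim: s s_uniq le_d => [_|a s IHs /= /andP[a_s s_uniq]] le_d.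
  have [BF dimF] := rowvs_sub_kermx Z_lead pencil_top_kernel.
  have [|_] := @dim_preimage _ _ _ (linfun (@top_pvec K n d)) (annihilator Z eps d) _ _ BF.
    apply/subvP => _ /memv_imgP[V VA ->]; rewrite lfunE mem_rowvs /=; apply/sub_kermxP.
    move: VA; rewrite mem_annihilator // => /eqP/rowP VZ; apply/rowP => j.
    rewrite /top_pvec -coef_mul_kernel // ?VZ ?mxE ?coef0 // => i.
    exact: size_pvec.
  rewrite dim_rowvs dimF big_nil /= => h; apply: arith0; apply: h.
  apply/subvP => u; rewrite mem_rowvs => /sub_kermxP uL.
  have [|v [v_deg vZ vu]] := interp_oo d u _ uL; first by move: le_d => /=; lia.
  apply/memv_imgP; exists (pvec_coef d.+1 v).
    by rewrite mem_annihilator // pvec_coefK // vZ.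
  by rewrite lfunE /= /top_pvec pvec_coefK.
have [aF dimF] := rowvs_sub_kermx (@Z_free a) (pencil_at_kernel a).
have [|_] := @dim_preimage _ _ _ (linfun (@eval_pvec K n d a)) (local_space d s) _ _ aF.
  apply/subvP => _ /memv_imgP[V /local_spaceP[VZ _ _] ->]; rewrite lfunE mem_rowvs /=; apply/sub_kermxP.
  by rewrite /eval_pvec /eval_row -map_mxM VZ map_mx0.
rewrite dim_rowvs dimF big_cons [(_.+2 * _)%N]mulSn => h; apply: arith.
  by apply: IHs => //; apply: leq_trans le_d; rewrite leq_add2l leqnSn.
apply: h; apply/subvP => u; rewrite mem_rowvs => /sub_kermxP uZ.
have [|v [v_deg vZ va vs]] := interp d a s u a_s _ uZ.
  by apply: leq_trans le_d; apply: leq_add; lia.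
have v_deg1 i : (size (v ord0 i) <= d.+1)%N by apply: leqW.
apply/memv_imgP; exists (pvec_coef d.+1 v); last by rewrite lfunE /= /eval_pvec pvec_coefK.
apply/local_spaceP; rewrite /top_pvec /eval_pvec pvec_coefK //; split=> // [|b /vs ->].
  rewrite (_ : coef_row d v = 0) ?sub0mx //.
  by apply/rowP => i; rewrite !mxE nth_default.
by rewrite sub0mx.
Qed.

(** Multiplication by ['X - b] embeds the space in degree [d] into the vectors of degree
    [d + 1] vanishing at [b], while the rows of the pencil, which have degree 1, take
    all admissible values at [b] because the rank is generic there. *)
Lemma dim_local_space_step d s b : (0 < d)%N -> \rank (A + b *: B)%R = (n - k)%N ->
  (\dim (local_space d s) + (n - k) <= \dim (local_space d.+1 s))%N.
Proof.
move=> d_gt0 b_rank.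
pose P := local_space d s; pose P' := local_space d.+1 s.
pose g := linfun (@mulXsub_pvec K n d b); pose ev := linfun (@eval_pvec K n d.+1 b).
have gE V : g V = mulXsub_pvec b V by rewrite lfunE.
have g_inj : (P :&: lker g = 0)%VS.
  apply/eqP; rewrite -subv0; apply/subvP => V; rewrite memv_cap memv_ker gE memv0 => /andP[_ /eqP V0].
  have := mulXsub_pvecE b V; rewrite V0 (_ : pvec 0 = 0); last first.
    by apply/rowP => i; rewrite !mxE row0 linear0.
  move/esym/eqP; rewrite scalemx_eq0 polyXsubC_eq0 /= => /eqP pV0.
  by rewrite -[V]pvecK pV0; apply/eqP/matrixP => i j; rewrite !mxE coef0.
have gP : (g @: P <= P' :&: lker ev)%VS.
  apply/subvP => _ /memv_imgP[V /local_spaceP[VZ VB Vs] ->].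
  rewrite memv_cap memv_ker gE lfunE /=; apply/andP; split; last first.
    rewrite /eval_pvec mulXsub_pvecE /eval_row map_mxZ /= /horner_eval !hornerE subrr scale0r.
    exact: eqxx.
  apply/local_spaceP; rewrite /top_pvec /eval_pvec mulXsub_pvecE; split=> [||a /Vs Va].
  - by rewrite -scalemxAl VZ scaler0.
  - suff -> : coef_row d.+1 (('X - b%:P) *: pvec V) = top_pvec V by [].
    apply/rowP => i; rewrite !mxE mulrBl coefB coefXM coefCM /=.
    by rewrite [X in b * X]nth_default ?mulr0 ?subr0 // size_poly.
  by rewrite /eval_row map_mxZ /= scalemx_sub.
have evP : (rowvs (A + b *: B) <= ev @: P')%VS.
  apply/subvP => _ /memv_imgP[w _ ->]; rewrite lfunE /=.
  pose v : 'rV[R]_n := map_mx polyC w *m M.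
  have v_deg i : (size (v ord0 i) <= 2)%N.
    rewrite mxE; apply: leq_trans (size_sum _ _ _) _; apply/bigmax_leqP => j _.
    rewrite mxE mul_polyC; apply: leq_trans (size_scale_leq _ _) _.
    exact: size_affine_pencil.
  have v_at a : eval_row a v = w *m (A + a *: B).
    rewrite /eval_row map_mxM /=; congr (_ *m _).
      by apply/rowP => i; rewrite !mxE /horner_eval hornerC.
    by apply/matrixP => i j; rewrite !mxE /horner_eval !hornerE.
  have v_deg' i : (size (v ord0 i) <= d.+2)%N by apply: leq_trans (v_deg i) _; lia.
  apply/memv_imgP; exists (pvec_coef d.+2 v).
    apply/local_spaceP; rewrite /top_pvec /eval_pvec pvec_coefK //; split=> [||a _].
    - by rewrite -mulmxA MZ mulmx0.
    - rewrite (_ : coef_row d.+1 v = 0) ?sub0mx //.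
      by apply/rowP => i; rewrite [LHS]mxE [RHS]mxE nth_default // (leq_trans (v_deg i)).
    by rewrite v_at submxMl.
  by rewrite lfunE /= /eval_pvec pvec_coefK // v_at.
have := dimvS gP; have := dimvS evP; rewrite dim_rowvs b_rank (limg_dim_eq g_inj).
by rewrite -/P -/P' -(limg_ker_dim ev P') => ? ?; rewrite leq_add.
Qed.

End LocalConditions.

Section DegreeOne.
Variables (K : closedFieldType) (n k : nat) (A B : 'M[K]_n).
Local Notation R := {poly K}.
Local Notation M := (affine_pencil A B).
Variables (Z : 'M[R]_(n, k)) (eps : 'I_k -> nat) (U : 'M[R]_(k, n)).
Hypothesis MZ : M *m Z = 0.
Hypothesis Z_free : forall a (c : 'cV[K]_k), map_mx (horner_eval a) Z *m c = 0 -> c = 0.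
Hypothesis Z_deg : forall i j, (size (Z i j) <= (eps j).+1)%N.
Hypothesis Z_lead : forall c : 'cV[K]_k, (\matrix_(i, j) (Z i j)`_(eps j)) *m c = 0 -> c = 0.
Hypothesis UZ : U *m Z = 1%:M.
Hypothesis le_kn : (k <= n)%N.

(** The conditions are independent already in degree one.  Their number bounds the dimension
    from below; for the upper bound, go up to a large degree and
    back by [dim_local_space_step]. *)
Lemma dim_local_space1 s b : uniq s -> \rank (A + b *: B)%R = (n - k)%N ->
  (n * 2 + \rank B + \sum_(a <- s) \rank (A + a *: B)%R =
   \dim (local_space A B Z eps 1 s) + (2 * k + \sum_j eps j) + (size s).+1 * (n - k))%N.
Proof.
move=> s_uniq b_rank.
have sum_deg d : (\sum_j (d + eps j).+1 = d * k + k + \sum_j eps j)%N.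
  under eq_bigr do rewrite -addSn.
  by rewrite big_split /= sum_nat_const card_ord; lia.
apply/eqP; rewrite eqn_leq; apply/andP; split.
  have arith (dA dL x rB sr m S : nat) : (x <= dA + (1 * k + k + S) -> dA + rB + sr <= dL + m ->
      x + rB + sr <= dL + (2 * k + S) + m)%N by lia.
  have [le_A _] := dim_annihilator Z_deg 1; rewrite sum_deg in le_A.
  exact: arith le_A (dim_local_space_geq MZ Z_free Z_deg Z_lead 1 s).
have [D dimD] := dim_local_space MZ Z_free Z_deg Z_lead UZ.
have step e : (\dim (local_space A B Z eps 1 s) + e * (n - k) <= \dim (local_space A B Z eps e.+1 s))%N.
  elim: e => [|e IHe]; first by rewrite mul0n addn0.
  apply: leq_trans (dim_local_space_step MZ Z_deg s (ltn0Sn e) b_rank).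
  by rewrite mulSn [(n - k + _)%N]addnC addnA leq_add2r.
have := dimD (D + size s).+1 s s_uniq (leqnSn _); rewrite sum_deg.
have := step (D + size s)%N; set e := (D + size s)%N.
have arith (dL dL' rB sr m S : nat) : (dL + e * (n - k) <= dL' ->
    n * e.+2 + rB + sr = dL' + (e.+1 * k + k + S) + m ->
    dL + (2 * k + S) + m <= n * 2 + rB + sr)%N.
  have -> : (n * e.+2 = n * 2 + e * (n - k) + e * k)%N.
    by rewrite -addnA -mulnDr subnK // -addn2 mulnDr addnC [(n * e)%N]mulnC.
  by move: (e * (n - k))%N => x; lia.
exact: arith.
Qed.

Lemma eval_pvec1 a (V : 'M[K]_(n, 2)) : eval_pvec a V = (col 0 V)^T + a *: (col 1 V)^T.
Proof.
apply/rowP => i; rewrite !mxE /horner_eval horner_poly big_ord_recl big_ord1 /=.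
rewrite !insubT //= !mxE /bump /= expr0 mulr1 expr1 [a * _]mulrC.
by congr (V i _ + V i _ * a); apply: val_inj.
Qed.

Lemma top_pvec1 (V : 'M[K]_(n, 2)) : top_pvec V = (col 1 V)^T.
Proof. by apply/rowP => i; rewrite !mxE coef_poly /= insubT //= !mxE; congr (V i _); apply: val_inj. Qed.

(** In degree one the vectors [p + 'X q] of the local space are exactly the pairs [(p, q)] such
    that every pair of scalars [(u p, u q)] is of the form [(w A u, w B u)]: the
    pairs [(w A u, w B u)] are the ones orthogonal to all [(c, d)] with
    [(c A + d B) u = 0]. *)
Lemma local_space1P (s : seq K) (V : 'M[K]_(n, 2)) :
    (forall a, a \notin s -> \rank (A + a *: B)%R = (n - k)%N) ->
  V \in local_space A B Z eps 1 s <->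
  forall u : 'rV[K]_n, exists w : 'rV[K]_n, u *m V = row_mx (w *m A *m u^T) (w *m B *m u^T).
Proof.
move=> s_rank; split=> [/(local_spaceP A B Z_deg)[VZ VB Vs] u|V_loc].
  have V_at a : (eval_pvec a V <= (A + a *: B)%R)%MS.
    have [/Vs //|/s_rank rank_a] := boolP (a \in s).
    have [aF dimF] := rowvs_sub_kermx (@Z_free a) (pencil_at_kernel MZ a).
    rewrite -mem_rowvs.
    have -> : rowvs (A + a *: B) = rowvs (kermx (map_mx (horner_eval a) Z)).
      by apply/eqP; rewrite eqEdim aF dimF dim_rowvs rank_a leqnn.
    by rewrite mem_rowvs; apply/sub_kermxP; rewrite /eval_pvec /eval_row -map_mxM VZ map_mx0.
  pose N : 'M[K]_(n, 1 + 1) := row_mx (A *m u^T) (B *m u^T).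
  have [w wN] : exists w, u *m V = w *m N.
    apply/submxP; rewrite submxE; apply/eqP/matrixP => i j; rewrite ord1 [RHS]mxE.
    set C := cokermx N; pose c := C (lshift 1 0) j; pose e := C (rshift 1 0) j.
    have NC l : (A *m u^T) l 0 * c + (B *m u^T) l 0 * e = 0.
      have /matrixP/(_ l j) := mulmx_coker N.
      rewrite mxE big_split_ord !big_ord1 row_mxEl row_mxEr [RHS]mxE; exact.
    have -> : (u *m V *m C) 0 j = ((col 0 V)^T *m u^T) 0 0 * c + ((col 1 V)^T *m u^T) 0 0 * e.
      have uVE l : (u *m V) 0 l = ((col l V)^T *m u^T) 0 0.
        by rewrite !mxE; apply: eq_bigr => l' _; rewrite !mxE mulrC.
      rewrite mxE big_ord_recl big_ord1 /= !uVE.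
      by congr (((col _ V)^T *m u^T) 0 0 * C _ j + ((col _ V)^T *m u^T) 0 0 * C _ j); apply: val_inj.
    have [c0|c_n0] := eqVneq c 0.
      have [-> |e_n0] := eqVneq e 0; first by rewrite c0 !mulr0 addr0.
      have Bu : B *m u^T = 0.
        apply/colP => l; have /eqP := NC l; rewrite c0 mulr0 add0r mulf_eq0 (negPf e_n0) orbF.
        by rewrite [RHS]mxE => /eqP.
      have [w Vw] := submxP VB; rewrite top_pvec1 in Vw.
      by rewrite c0 mulr0 add0r Vw -mulmxA Bu mulmx0 mxE mul0r.
    have ABu : (A + (e / c) *: B) *m u^T = 0.
      apply/colP => l; apply: (mulIf c_n0); rewrite [(0 : 'cV_n) _ _]mxE mul0r -(NC l).
      by rewrite mulmxDl -scalemxAl mxE [X in _ + X]mxE; field.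
    have [w Vw] := submxP (V_at (e / c)); rewrite eval_pvec1 in Vw.
    have := congr1 (fun v => (v *m u^T) 0 0) Vw; rewrite -mulmxA ABu mulmx0 [RHS]mxE.
    rewrite mulmxDl -scalemxAl mxE [X in _ + X]mxE => Vu.
    have -> : ((col 0 V)^T *m u^T) 0 0 = - (e / c * ((col 1 V)^T *m u^T) 0 0).
      by apply/eqP; rewrite -addr_eq0 Vu.
    by field.
  by exists w; rewrite wN /N mul_mx_row !mulmxA.
have mul_col (l : 'I_2) (u : 'rV[K]_n) : ((col l V)^T *m u^T) 0 0 = (u *m V) 0 l.
  by rewrite !mxE; apply: eq_bigr => i _; rewrite !mxE mulrC.
have mul_col0 (u w : 'rV[K]_n) : u *m V = row_mx (w *m A *m u^T) (w *m B *m u^T) ->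
    (u *m V) 0 0 = (w *m A *m u^T) 0 0.
  by move=> ->; rewrite -[RHS](row_mxEl _ (w *m B *m u^T)); congr (fun_of_matrix _ _ _); apply: val_inj.
have mul_col1 (u w : 'rV[K]_n) : u *m V = row_mx (w *m A *m u^T) (w *m B *m u^T) ->
    (u *m V) 0 1 = (w *m B *m u^T) 0 0.
  by move=> ->; rewrite -[RHS](row_mxEr (w *m A *m u^T)); congr (fun_of_matrix _ _ _); apply: val_inj.
have V_at a : (eval_pvec a V <= (A + a *: B)%R)%MS.
  rewrite submxE; apply/eqP/rowP => j; rewrite [RHS]mxE.
  set N := A + a *: B; pose u : 'rV[K]_n := (col j (cokermx N))^T.
  have Nu : N *m u^T = 0 by rewrite trmxK colE mulmxA mulmx_coker mul0mx.
  have [w uV] := V_loc u.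
  have -> : (eval_pvec a V *m cokermx N) 0 j = (eval_pvec a V *m u^T) 0 0.
    by rewrite trmxK [col j _]colE mulmxA -colE [RHS]mxE.
  rewrite eval_pvec1 mulmxDl -scalemxAl mxE [X in _ + X]mxE !mul_col.
  rewrite (mul_col0 _ _ uV) (mul_col1 _ _ uV).
  have /matrixP/(_ 0 0) : w *m N *m u^T = 0 by rewrite -mulmxA Nu mulmx0.
  by rewrite mulmxDr mulmxDl -scalemxAr -scalemxAl mxE [X in _ + X]mxE [RHS]mxE.
apply/local_spaceP => //; split=> // [|].
  apply/rowP => j; rewrite [RHS]mxE; apply/eqP/contraT => /closed_nonrootP[a].
  case/negP; rewrite /root -/(horner_eval a _).
  have -> : horner_eval a ((pvec V *m Z) 0 j) = (eval_pvec a V *m map_mx (horner_eval a) Z) 0 j.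
    by rewrite /eval_pvec /eval_row -map_mxM [RHS]mxE.
  have [w ->] := submxP (V_at a).
  by rewrite -mulmxA (pencil_at_kernel MZ) mulmx0 mxE.
rewrite top_pvec1 submxE; apply/eqP/rowP => j; rewrite [RHS]mxE.
pose u : 'rV[K]_n := (col j (cokermx B))^T; have [w uV] := V_loc u.
have -> : ((col 1 V)^T *m cokermx B) 0 j = ((col 1 V)^T *m u^T) 0 0.
  by rewrite /u trmxK; move: (cokermx B) => C; rewrite [col j _]colE mulmxA -colE [RHS]mxE.
rewrite mul_col (mul_col1 _ _ uV) -mulmxA.
by rewrite (_ : B *m u^T = 0) ?mulmx0 ?mxE // trmxK colE mulmxA mulmx_coker mul0mx.
Qed.

End DegreeOne.

(** A constant solution depends on the minimal solutions of degree 0, first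
    over the polynomials and then, by evaluating at a point where its coefficient is
    nonzero, over the constants. *)
Lemma constant_solutions (K : closedFieldType) n (A B : 'M[K]_n) (x : seq 'cV[{poly K}]_n) k0 :
    A^T = - A -> B^T = - B -> minimal_solutions A B x -> (k0 <= size x)%N ->
    (forall j, (j < k0)%N -> vdeg x`_j = 0%N) ->
    ((k0 < size x)%N -> vdeg x`_k0 != 0%N) ->
  exists2 N : 'M[K]_(k0, n), row_free N &
    forall w : 'rV[K]_n, (w <= N)%MS = (w *m A == 0) && (w *m B == 0).
Proof.
move=> A_skew B_skew x_min le_k0 deg0 deg_k0.
pose N : 'M[K]_(k0, n) := \matrix_(j, i) (x`_j i ord0).[0].
have x_const j i : (j < k0)%N -> x`_j i ord0 = ((x`_j i ord0).[0])%:P.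
  move=> lt_j; have := size_minimal_solution x j i; rewrite deg0 // => /size1_polyC ->.
  by rewrite hornerC.
have skew_mul (C : 'M[K]_n) (w : 'rV[K]_n) : C^T = - C -> (w *m C == 0) = (C *m w^T == 0).
  move=> C_skew; rewrite -(inj_eq (@trmx_inj _ _ _)) trmx_mul C_skew mulNmx trmx0.
  by rewrite oppr_eq0.
have solE (w : 'rV[K]_n) : affine_pencil A B *m (map_mx polyC w)^T = 0 <->
    (w *m A == 0) && (w *m B == 0).
  rewrite !skew_mul // map_trmx /affine_pencil mulmxDl -scalemxAl -!map_mxM.
  split=> [AB0|/andP[/eqP-> /eqP->]]; last by rewrite !map_mx0 scaler0 addr0.
  have coef_AB i l : (((A *m w^T) i 0)%:P + 'X * ((B *m w^T) i 0)%:P)`_l = 0 :> K.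
    by have /matrixP/(_ i 0)/(congr1 (fun p : {poly K} => p`_l)) := AB0; rewrite !mxE coef0.
  apply/andP; split; apply/eqP/colP => i; rewrite [RHS]mxE.
    by have := coef_AB i 0%N; rewrite coefD coefC coefXM addr0.
  by have := coef_AB i 1%N; rewrite coefD coefC coefXM coefC add0r.
exists N.
  apply: inj_row_free => u uN; apply/rowP => j; rewrite [RHS]mxE.
  pose c l := if insub l is Some o then u 0 o else 0.
  have <- : c j = u 0 j by rewrite /c valK.
  apply: (minimal_solutions_at x_min (a := 0)) (leq_trans (ltn_ord j) le_k0) => i.
  rewrite (bigID (fun l : 'I_(size x) => (l < k0)%N)) /= [X in _ + X]big1 ?addr0 => [|l]; last first.
    by rewrite -leqNgt /c => le_l; rewrite insubN ?mul0r // -leqNgt.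
  have /rowP/(_ i) := uN; rewrite [RHS]mxE mxE => h; apply: etrans h.
  rewrite (big_ord_narrow le_k0) /=; apply: eq_bigr => l _.
  by rewrite /c valK mxE.
move=> w; apply/idP/idP => [/submxP[u ->]|/solE w_sol].
  apply/solE; rewrite map_mxM trmx_mul mulmxA.
  rewrite (_ : affine_pencil A B *m _ = 0) ?mul0mx //.
  apply/matrixP => i j; rewrite [RHS]mxE.
  have := minimal_solution x_min (leq_trans (ltn_ord j) le_k0).
  move/colP/(_ i); rewrite [RHS]mxE mxE => h.
  rewrite mxE; apply: etrans h; apply: eq_bigr => l _; congr (_ * _).
  by rewrite !mxE [RHS]x_const.
have [c cP c_n0] : exists2 c : nat -> {poly K},
    \sum_(i < k0) c i *: x`_i + c k0 *: (map_mx polyC w)^T = 0 & ~ (forall i, (i <= k0)%N -> c i = 0).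
  apply: contrapT => no_c.
  have w_indep : lin_indep (rcons (take k0 x) (map_mx polyC w)^T).
    apply/(lin_indep_rconsP _ le_k0) => c c0; apply: contrapT => c_n0.
    by apply: no_c; exists c.
  have [x_deg x_max] := x_min.
  move: le_k0; rewrite leq_eqVlt => /orP[/eqP k0E|lt_k0].
    by apply: (x_max _ w_sol); rewrite k0E take_size in w_indep.
  have [_ _ /(_ _ w_sol w_indep)] := x_deg _ lt_k0.
  suff -> : vdeg (map_mx polyC w)^T = 0%N by rewrite leqn0; apply/negP/deg_k0.
  apply/eqP; rewrite -leqn0 /vdeg -subn1 leq_subLR addn0; apply/bigmax_leqP => i _.
  by rewrite !mxE size_polyC_leq1.
have ck_n0 : c k0 != 0.
  apply/eqP => ck0; apply: c_n0 => j; rewrite leq_eqVlt => /orP[/eqP-> //|lt_j].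
  by move: cP; rewrite ck0 scale0r addr0 => cP; apply: (minimal_indep x_min le_k0 cP).
have /closed_nonrootP[a ca] := ck_n0.
apply/submxP; exists (\row_j (- (c j).[a] / (c k0).[a])).
apply/rowP => i; apply: (mulfI ca).
have /colP/(_ i)/(congr1 (horner_eval a)) := cP.
rewrite mxE summxE [X in _ = horner_eval a X]mxE rmorph0 rmorphD /= => /eqP; rewrite addrC addr_eq0 => /eqP.
rewrite !mxE /horner_eval hornerM hornerC => ->; rewrite horner_sum -sumrN big_distrr.
apply: eq_bigr => j _ /=; rewrite !mxE hornerM x_const // !hornerC.
by rewrite mulrA mulNr mulrN mulrCA mulfV ?mulr1 ?mulNr.
Qed.

(** * Almost inner derivations in coordinates *)

Section TwoStepNilpotent.
Variables (K : fieldType) (g : lieAlgType K) (n : nat) (A B : 'M[K]_n).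
Variables (x : n.-tuple g) (y1 y2 : g).
Hypothesis g_nil : two_step_nilpotent g.
Hypothesis xy_basis : basis_of fullv (x ++ [:: y1; y2]).
Hypothesis y_basis : basis_of (derived_algebra g) [:: y1; y2].
Hypothesis lie_x : forall i j, lie (tnth x i) (tnth x j) = A i j *: y1 + B i j *: y2.

Let X : (n + 2).-tuple g := [tuple of x ++ [:: y1; y2]].

Lemma lie_opp (u v : g) : lie u v = - lie v u.
Proof.
have := liexx (u + v); rewrite lieDl !linearD /= !liexx addr0 add0r => /eqP.
by rewrite addr_eq0 => /eqP.
Qed.

Lemma derived_memP z : z \in derived_algebra g <-> exists a b, z = a *: y1 + b *: y2.
Proof.
rewrite -(span_basis y_basis) span_cons span_seq1.
split=> [/memv_addP[_ /vlineP[a ->] [_ /vlineP[b ->] ->]]|[a [b ->]]]; first by exists a, b.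
by rewrite memv_add // memvZ // memv_line.
Qed.

Lemma lie_derivedr u z : z \in derived_algebra g -> lie u z = 0.
Proof.
move=> zg; apply/eqP; rewrite -memv0 -[0%VS]g_nil.
by apply: mem_liev; rewrite ?memvf.
Qed.

Lemma lie_derivedl u z : z \in derived_algebra g -> lie z u = 0.
Proof. by move=> zg; rewrite lie_opp lie_derivedr ?oppr0. Qed.

Lemma derived_free a b : a *: y1 + b *: y2 = 0 -> a = 0 /\ b = 0.
Proof.
move=> ab0; have /freeP y_free := basis_free y_basis.
pose c (i : 'I_2) := if i == 0 then a else b.
have c0 : \sum_(i < 2) c i *: [:: y1; y2]`_i = 0 by rewrite big_ord_recl big_ord1.
by have := y_free c c0 0; have := y_free c c0 1.
Qed.

Let X_lshift (i : 'I_n) : X`_(lshift 2 i) = tnth x i.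
Proof. by rewrite /= nth_cat size_tuple ltn_ord (tnth_nth 0). Qed.

Let X_rshift (i : 'I_2) : X`_(rshift n i) = [:: y1; y2]`_i.
Proof. by rewrite /= nth_cat size_tuple ltnNge leq_addr addKn. Qed.

Let X_free : free X. Proof. exact: basis_free xy_basis. Qed.

Definition cvec (u : g) : 'rV[K]_n := \row_i coord X (lshift 2 i) u.

Fact cvec_linear : linear cvec.
Proof. by move=> a u v; apply/rowP => i; rewrite !mxE linearP. Qed.
HB.instance Definition _ := GRing.isLinear.Build K g 'rV[K]_n *:%R cvec cvec_linear.

Lemma cvec_decomposition u :
  exists2 z, z \in derived_algebra g & u = \sum_i cvec u 0 i *: tnth x i + z.
Proof.
have uE : u = \sum_i coord X i u *: X`_i by apply: coord_basis xy_basis (memvf u).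
exists (\sum_i coord X (rshift n i) u *: X`_(rshift n i)).
  rewrite big_ord_recl big_ord1 !X_rshift; apply/derived_memP.
  by exists (coord X (rshift n ord0) u), (coord X (rshift n (lift ord0 ord0)) u).
rewrite {1}uE big_split_ord; congr (_ + _).
by apply: eq_bigr => i _; rewrite X_lshift mxE.
Qed.

Lemma cvec_derived z : z \in derived_algebra g -> cvec z = 0.
Proof.
move=> /derived_memP[a [b ->]]; apply/rowP => i; rewrite !mxE linearD !linearZ /=.
have Xy (j : 'I_2) : coord X (lshift 2 i) [:: y1; y2]`_j = 0.
  by rewrite -X_rshift coord_free // eq_rlshift.
by have := Xy ord0; have := Xy ord_max => /= -> ->; rewrite !mulr0 addr0.
Qed.

Lemma cvecK (w : 'rV[K]_n) : cvec (\sum_i w 0 i *: tnth x i) = w.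
Proof.
apply/rowP => i; rewrite mxE linear_sum (bigD1 i) //= linearZ /= -X_lshift coord_free // eqxx.
rewrite mulr1 big1 ?addr0 // => j ne_ji; rewrite linearZ /= -X_lshift coord_free //.
by rewrite (inj_eq (@lshift_inj _ _)) (negPf ne_ji) mulr0.
Qed.

Lemma lieE u v : lie u v =
  (cvec u *m A *m (cvec v)^T) 0 0 *: y1 + (cvec u *m B *m (cvec v)^T) 0 0 *: y2.
Proof.
have [z zg uE] := cvec_decomposition u; have [t tg vE] := cvec_decomposition v.
rewrite {1}uE {1}vE linearD /= (lie_derivedr _ tg) addr0 lieDl (lie_derivedl _ zg) addr0.
have mulE (C : 'M[K]_n) : (cvec u *m C *m (cvec v)^T) 0 0 =
    \sum_i \sum_j cvec u 0 i * cvec v 0 j * C i j.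
  rewrite -mulmxA mxE; apply: eq_bigr => i _; rewrite [(C *m _) _ _]mxE mulr_sumr.
  by apply: eq_bigr => j _; rewrite [(cvec v)^T _ _]mxE; ring.
rewrite !mulE !scaler_suml -big_split.
rewrite (big_morph (fun u => lie u _) (fun u v => lieDl u v _) (lie0l _)).
apply: eq_bigr => i _; rewrite linear_sum /= !scaler_suml -big_split.
by apply: eq_bigr => j _ /=; rewrite lieZl linearZ /= lie_x scalerA scalerDr !scalerA.
Qed.

Lemma pencil_skew : A^T = - A /\ B^T = - B.
Proof.
have AB i j : A j i = - A i j /\ B j i = - B i j.
  have : (A i j + A j i) *: y1 + (B i j + B j i) *: y2 = 0.
    by rewrite !scalerDl addrACA -!lie_x lie_opp addNr.
  case/derived_free => /eqP; rewrite addr_eq0 => /eqP-> /eqP.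
  by rewrite addr_eq0 => /eqP->; rewrite !opprK.
by split; apply/matrixP => i j; rewrite !mxE; case: (AB i j).
Qed.

(** [psi V] vanishes on the derived algebra and takes values in it, so it is a derivation for every [V]. *)
Definition psi (V : 'M[K]_(n, 2)) (u : g) : g :=
  (cvec u *m V) 0 0 *: y1 + (cvec u *m V) 0 1 *: y2.

Fact psi_linear V : linear (psi V).
Proof.
move=> a u v; rewrite /psi linearP mulmxDl -scalemxAl.
rewrite [X in X *: y1]mxE [X in X *: y2]mxE [X in (X + _) *: y1]mxE [X in (X + _) *: y2]mxE.
by rewrite !scalerDl scalerDr !scalerA addrACA.
Qed.
HB.instance Definition _ V := GRing.isLinear.Build K g g *:%R (psi V) (psi_linear V).

Definition Psi V : 'End(g) := linfun (psi V).

Lemma PsiE V u : Psi V u = psi V u.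
Proof. by rewrite lfunE. Qed.

Fact Psi_linear : linear Psi.
Proof.
move=> a V W; apply/lfunP => u; rewrite add_lfunE scale_lfunE !PsiE /psi.
rewrite mulmxDr -scalemxAr.
rewrite [X in X *: y1]mxE [X in X *: y2]mxE [X in (X + _) *: y1]mxE [X in (X + _) *: y2]mxE.
by rewrite !scalerDl scalerDr !scalerA addrACA.
Qed.
HB.instance Definition _ := GRing.isLinear.Build K _ _ *:%R Psi Psi_linear.

Lemma row2P (v w : 'rV[K]_2) : v 0 0 = w 0 0 -> v 0 1 = w 0 1 -> v = w.
Proof.
move=> vw0 vw1; apply/rowP => i; have [->//|/eqP i_n0] := i =P 0.
suff -> : i = 1 by []. 
by apply: val_inj; move: i_n0; rewrite -val_eqE /=; case: i => [[|[|]]].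
Qed.

Lemma psi_eq V W u : psi V u = psi W u -> cvec u *m V = cvec u *m W.
Proof.
move/eqP; rewrite -subr_eq0 /psi opprD addrACA -!scalerBl => /eqP/derived_free[].
by move=> /eqP + /eqP; rewrite !subr_eq0 => /eqP V0 /eqP V1; apply: row2P.
Qed.

Lemma Psi_inj : injective Psi.
Proof.
move=> V W VW; apply/row_matrixP => i; rewrite !rowE -[delta_mx 0 i]cvecK.
apply: psi_eq.
have := congr1 (fun f : 'End(g) => f (\sum_(j < n) (delta_mx 0 i : 'rV[K]_n) 0 j *: tnth x j)) VW.
by rewrite /= !PsiE.
Qed.

Lemma row_mx2 (a b : 'M[K]_1) : (row_mx a b : 'rV[K]_2) 0 0 = a 0 0 /\ (row_mx a b : 'rV[K]_2) 0 1 = b 0 0.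
Proof.
split; first by rewrite -[RHS](row_mxEl _ b); congr (fun_of_matrix _ _ _); apply: val_inj.
by rewrite -[RHS](row_mxEr a); congr (fun_of_matrix _ _ _); apply: val_inj.
Qed.

Lemma almost_innerP D : almost_inner D <-> exists2 V : 'M[K]_(n, 2), D = Psi V &
  forall u : 'rV[K]_n, exists w : 'rV[K]_n, u *m V = row_mx (w *m A *m u^T) (w *m B *m u^T).
Proof.
split=> [[_ D_inner]|[V -> V_inner]].
  have D_derived z : z \in derived_algebra g -> D z = 0.
    by move=> zg; have [u ->] := D_inner z; apply: lie_derivedr.
  have /choice[ab abE] (i : 'I_n) : exists ab : K * K, D (tnth x i) = ab.1 *: y1 + ab.2 *: y2.
    have [u ->] := D_inner (tnth x i).
    have /derived_memP[a [b ->]] := mem_liev (memvf u) (memvf (tnth x i)).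
    by exists (a, b).
  pose V : 'M[K]_(n, 2) := \matrix_(i, j) (if j == 0 then (ab i).1 else (ab i).2).
  have DE : D = Psi V.
    apply/lfunP => u; rewrite PsiE /psi; have [z zg uE] := cvec_decomposition u.
    rewrite {1}uE linearD /= (D_derived _ zg) addr0 linear_sum /= !mxE !scaler_suml -big_split.
    by apply: eq_bigr => i _; rewrite linearZ /= abE scalerDr !scalerA !mxE.
  exists V => // u; have [y] := D_inner (\sum_i u 0 i *: tnth x i).
  rewrite DE PsiE /psi lieE cvecK => uV; exists (cvec y).
  set a := _ *m A *m _ in uV *; set b := _ *m B *m _ in uV *.
  have [ab0 ab1] := row_mx2 a b.
  move/eqP: uV; rewrite -subr_eq0 opprD addrACA -!scalerBl => /eqP/derived_free[].
  by move=> /eqP + /eqP; rewrite !subr_eq0 => /eqP V0 /eqP V1; apply: row2P; rewrite ?V0 ?V1 ?ab0 ?ab1.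
have psi_derived u : psi V u \in derived_algebra g.
  by apply/derived_memP; exists ((cvec u *m V) 0 0), ((cvec u *m V) 0 1).
split=> [u v|u]; rewrite !PsiE.
  rewrite (lie_derivedl _ (psi_derived u)) (lie_derivedr _ (psi_derived v)) addr0 /psi cvec_derived.
    by rewrite mul0mx !mxE !scale0r addr0.
  exact: mem_liev (memvf u) (memvf v).
have [w uV] := V_inner (cvec u); exists (\sum_i w 0 i *: tnth x i).
rewrite lieE cvecK /psi uV.
by have [-> ->] := row_mx2 (w *m A *m (cvec u)^T) (w *m B *m (cvec u)^T).
Qed.

(** The coordinates of inner derivations, see [ad_omega]. *)
Definition omega (w : 'rV[K]_n) : 'M[K]_(n, 2) := row_mx (w *m A)^T (w *m B)^T.

Fact omega_linear : linear omega.
Proof.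
move=> a v w; rewrite /omega !mulmxDl -!scalemxAl !linearP /=.
by rewrite -add_row_mx -scale_row_mx.
Qed.
HB.instance Definition _ := GRing.isLinear.Build K _ _ *:%R omega omega_linear.

Lemma ad_omega u : ad u = Psi (omega (cvec u)).
Proof.
apply/lfunP => v; rewrite lfunE PsiE /= lieE /psi.
have -> : cvec v *m omega (cvec u) =
    row_mx (cvec v *m (cvec u *m A)^T) (cvec v *m (cvec u *m B)^T).
  exact: (@mul_mx_row K 1 n 1 1 (cvec v)).
have [-> ->] := row_mx2 (cvec v *m (cvec u *m A)^T) (cvec v *m (cvec u *m B)^T).
by rewrite -[cvec v]trmxK -!trmx_mul trmxK !mxE.
Qed.

Lemma dim_Inn : \dim (Inn g) = (n - \dim (lker (linfun omega)))%N.
Proof.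
have -> : Inn g = (linfun Psi @: limg (linfun omega))%VS.
  apply/vspaceP => D; apply/idP/idP.
    move/InnP=> [u ->]; rewrite ad_omega -[Psi _](lfunE (Psi : {linear _ -> _})) memv_img //.
    by apply/memv_imgP; exists (cvec u); rewrite ?memvf // lfunE.
  move=> /memv_imgP[V /memv_imgP[w _ ->] ->]; apply/InnP.
  by exists (\sum_i w 0 i *: tnth x i); rewrite ad_omega cvecK !lfunE.
rewrite limg_dim_eq; last first.
  apply/eqP; rewrite -subv0; apply/subvP => V; rewrite memv_cap memv_ker lfunE memv0 /=.
  by case/andP=> _ /eqP; rewrite -(linear0 Psi) => /Psi_inj->.
have := limg_ker_dim (linfun omega) fullv; rewrite capfv [RHS]dimvf [RHS]/dim /= mul1n.
have arith (a b m : nat) : (a + b = m -> b = m - a)%N by lia.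
exact: arith.
Qed.

End TwoStepNilpotent.

(** * The dimension formula *)

Lemma nonsingular_minimal_solutions (K : fieldType) n (A B : 'M[K]_n) :
  \det (pencil A B) != 0 -> minimal_solutions A B [::].
Proof.
move=> det_n0; split=> // z z_sol /lin_indepP/(_ (fun=> 1)).
have aff_n0 : \det (affine_pencil A B) != 0.
  have [_] := det_mxsub_pencil A B id id; rewrite !mxsub_id => detE.
  by apply: contraNneq det_n0 => d0; rewrite detE d0 homog0.
have z0 : z = 0.
  apply/eqP; have := congr1 (mulmx (\adj (affine_pencil A B))) z_sol.
  by rewrite mulmx0 mulmxA mul_adj_mx mul_scalar_mx => /eqP; rewrite scalemx_eq0 (negPf aff_n0).
rewrite /= big_ord1 /= z0 scaler0 => /(_ erefl 0%N (ltn0Sn 0))/eqP.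
by rewrite oner_eq0.
Qed.

Lemma sum_count_undup (T : eqType) (t : seq T) :
  (\sum_(a <- undup t) count (pred1 a) t)%N = size t.
Proof.
under eq_bigr do rewrite -sum1_count big_mkcond /=.
rewrite exchange_big /= -[RHS]sum1_size; apply: eq_big_seq => b bt.
rewrite -big_mkcond sum1_count; transitivity (count (pred1 b) (undup t)).
  by apply: eq_count => a /=; rewrite eq_sym.
by rewrite count_uniq_mem ?undup_uniq // mem_undup bt.
Qed.

Lemma sum_predn_nonzero (s : seq nat) k0 : (k0 <= size s)%N ->
    (forall j, (j < k0)%N -> s`_j = 0%N) -> (forall j, (k0 <= j < size s)%N -> s`_j != 0%N) ->
  (\sum_(e <- s | e != 0) (e - 1) + (size s - k0) = \sum_(e <- s) e)%N.
Proof.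
elim: s k0 => [|e s IHs] [|k0] //= le_k0 s0 s_n0.
- by rewrite !big_nil.
- rewrite !big_cons /=; have e_n0 : e != 0%N by apply: (s_n0 0%N).
  rewrite e_n0 -(IHs 0%N) //; last by move=> j lt_j; apply: (s_n0 j.+1).
  by rewrite !subn0; move: e_n0; case: e {s0 s_n0} => // e _; lia.
have e0 : e = 0%N by apply: (s0 0%N).
rewrite !big_cons e0 /= add0n subSS; apply: IHs => // j lt_j.
  by apply: (s0 j.+1).
by apply: (s_n0 j.+1).
Qed.

Section SolutionMatrix.
Variables (K : closedFieldType) (n : nat) (A B : 'M[K]_n) (x : seq 'cV[{poly K}]_n).
Hypothesis x_min : minimal_solutions A B x.
Local Notation M := (affine_pencil A B).
Local Notation k := (size x).
Local Notation Z := (solution_mx x).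
Let eps (j : 'I_k) := vdeg x`_j.

Let nat_fun (c : 'cV[K]_k) j := if insub j is Some o then c o 0 else 0.
Let nat_funE c (j : 'I_k) : nat_fun c j = c j 0. Proof. by rewrite /nat_fun valK. Qed.

Lemma solution_mx_free a (c : 'cV[K]_k) : map_mx (horner_eval a) Z *m c = 0 -> c = 0.
Proof.
move=> c0; apply/colP => j; rewrite [RHS]mxE -nat_funE.
apply: (minimal_solutions_at x_min (a := a)) (ltn_ord j) => i.
have /colP/(_ i) := c0; rewrite [RHS]mxE mxE => h; apply: etrans h.
by apply: eq_bigr => l _; rewrite nat_funE !mxE mulrC.
Qed.

Lemma solution_mx_lead (c : 'cV[K]_k) : (\matrix_(i, j) (Z i j)`_(eps j)) *m c = 0 -> c = 0.
Proof.
move=> c0; apply/colP => j; rewrite [RHS]mxE -nat_funE.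
apply: (minimal_solutions_leading x_min) (ltn_ord j) => i.
have /colP/(_ i) := c0; rewrite [RHS]mxE mxE => h; apply: etrans h.
by apply: eq_bigr => l _; rewrite nat_funE !mxE mulrC.
Qed.

Lemma size_solution_mx i j : (size (Z i j) <= (eps j).+1)%N.
Proof. by rewrite mxE size_minimal_solution. Qed.

End SolutionMatrix.

Lemma affine_pencil_skew (K : fieldType) n (A B : 'M[K]_n) :
  A^T = - A -> B^T = - B -> (affine_pencil A B)^T = - affine_pencil A B.
Proof.
move=> A_skew B_skew; apply/matrixP => i j; rewrite !mxE.
have /matrixP/(_ i j) := A_skew; have /matrixP/(_ i j) := B_skew; rewrite !mxE => -> ->.
by rewrite !polyCN mulrN opprD.
Qed.

Lemma degree_formula (K : closedFieldType) n r k (A B : 'M[K]_n) (Z : 'M[{poly K}]_(n, k))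
    (eps : 'I_k -> nat) es afs :
    n = (r + k)%N -> (affine_pencil A B)^T = - affine_pencil A B ->
    affine_pencil A B *m Z = 0 ->
    (forall a (c : 'cV[K]_k), map_mx (horner_eval a) Z *m c = 0 -> c = 0) ->
    (forall i j, (size (Z i j) <= (eps j).+1)%N) ->
    (forall c : 'cV[K]_k, (\matrix_(i, j) (Z i j)`_(eps j)) *m c = 0 -> c = 0) ->
    frac_rank (affine_pencil A B) = r ->
    elementary_divisors (pencil A B) (paired_divisors es afs) ->
  r = (2 * \sum_j eps j + 2 * \sum_(e <- es) e + 2 * \sum_(af <- afs) af.2)%N.
Proof.
move=> nE; subst n => M_skew MZ Z_free Z_deg Z_lead M_rank elem_div.
exact: minimal_indices_degree_formula M_skew MZ Z_free Z_deg Z_lead M_rank _ _ elem_div.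
Qed.

Lemma poly_left_inverse (K : closedFieldType) n r k (Z : 'M[{poly K}]_(n, k)) :
    n = (r + k)%N -> (forall a (c : 'cV[K]_k), map_mx (horner_eval a) Z *m c = 0 -> c = 0) ->
  exists U : 'M[{poly K}]_(k, n), U *m Z = 1%:M.
Proof. by move=> nE; subst n; apply: kernel_basis_left_inverse. Qed.

Lemma sum_predn_pos (T : Type) (s : seq T) (f : T -> nat) : all (fun a => 0 < f a)%N s ->
  (\sum_(a <- s) (f a - 1) + size s = \sum_(a <- s) f a)%N.
Proof.
elim: s => [_|a s IHs /= /andP[a_gt0 /IHs {}IHs]]; first by rewrite !big_nil.
by rewrite !big_cons -IHs; lia.
Qed.

Theorem theorem5p10 (K : closedFieldType) (charK : 2%N \notin [pchar K])
    (g : lieAlgType K) (g_nil : two_step_nilpotent g) (g_genus : genus2 g)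
    (n : nat) (A B : 'M[K]_n) (g_pencil : associated_pencil g A B)
    (eps : seq nat) (min_eps : minimal_indices A B eps)
    (es : seq nat) (afs : seq (K * nat))
    (es_gt0 : forall e, e \in es -> (0 < e)%N)
    (afs_gt0 : forall af, af \in afs -> (0 < af.2)%N)
    (elem_div : elementary_divisors (pencil A B) (paired_divisors es afs)) :
  \dim (AID g) =
    (\dim (Inn g) + \sum_(e <- eps | e != 0) (e - 1)
     + 2 * (\sum_(e <- es) (e - 1)) + 2 * (\sum_(af <- afs) (af.2 - 1)))%N.
Proof.
have [t [y1 [y2 [xy_basis y_basis lie_t]]]] := g_pencil.
have [A_skew B_skew] := pencil_skew y_basis lie_t.
have [x x_min epsE] : exists2 x, minimal_solutions A B x & eps = [seq vdeg z | z <- x].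
  move: min_eps; rewrite /minimal_indices; case: ifP => // /negbT det_n0 ->.
  by exists [::] => //; apply: nonsingular_minimal_solutions.
pose k := size x; pose e (j : 'I_k) := vdeg x`_j; pose Z := solution_mx x.
pose r := frac_rank (affine_pencil A B).
have rk : (r + k)%N = n := frac_rank_minimal_solutions x_min.
have MZ : affine_pencil A B *m Z = 0 := mul_pencil_solution_mx x_min.
have Z_free := solution_mx_free x_min; rewrite -/Z in Z_free.
have Z_lead := solution_mx_lead x_min; rewrite -/Z in Z_lead.
have Z_deg := @size_solution_mx _ _ x; rewrite -/Z in Z_deg.
have M_skew := affine_pencil_skew A_skew B_skew.
have r_formula : r = (2 * \sum_j e j + 2 * \sum_(e <- es) e + 2 * \sum_(af <- afs) af.2)%N.
  exact: degree_formula (esym rk) M_skew MZ Z_free Z_deg Z_lead (erefl _) elem_div.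
have [U UZ] := poly_left_inverse (esym rk) Z_free.
have rank_s := rank_at afs_gt0 elem_div; have rank_oo := rank_at_infinity es_gt0 elem_div.
rewrite -/r in rank_s rank_oo.
pose s := undup [seq af.1 | af <- afs].
have rE : r = (n - k)%N by rewrite -rk addnK.
have rank_generic a : a \notin s -> \rank (A + a *: B)%R = (n - k)%N.
  rewrite mem_undup => a_s; rewrite -rE -(rank_s a).
  rewrite (@eq_in_count _ _ pred0) ?count_pred0 // => af af_afs /=.
  by apply: contraNF a_s => /eqP<-; apply: map_f.
have [b b_s] : exists b, b \notin s.
  have /closed_nonrootP[b] : \prod_(a <- s) ('X - a%:P) != 0.
    by apply/monic_neq0/monic_prod_XsubC.
  by rewrite root_prod_XsubC; exists b.
have le_kn : (k <= n)%N by rewrite -rk leq_addl.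
have dimL := dim_local_space1 MZ Z_free Z_deg Z_lead UZ le_kn
  (undup_uniq [seq af.1 | af <- afs]) (rank_generic b b_s).
have AID_E : AID g = (linfun (Psi t y1 y2) @: local_space A B Z e 1 s)%VS.
  apply/vspaceP => D; apply/idP/memv_imgP.
    move/AIDP/(almost_innerP g_nil xy_basis y_basis lie_t) => [V -> V_inner].
    exists V; last by rewrite lfunE.
    by apply/(local_space1P MZ Z_free Z_deg V rank_generic).
  move=> [V /(local_space1P MZ Z_free Z_deg V rank_generic) V_inner ->].
  apply/AIDP/(almost_innerP g_nil xy_basis y_basis lie_t).
  by exists V; rewrite ?lfunE.
have dim_AID : \dim (AID g) = \dim (local_space A B Z e 1 s).
  rewrite AID_E limg_dim_eq //; apply/eqP; rewrite -subv0; apply/subvP => V.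
  rewrite memv_cap memv_ker lfunE memv0 /= => /andP[_ /eqP].
  by rewrite -(linear0 (Psi t y1 y2)) => /(Psi_inj xy_basis y_basis)->.
(* The minimal indices equal to 0 are the first [k0] ones and count the constant solutions. *)
pose k0 := find (fun d => d != 0%N) eps.
have size_eps : size eps = k by rewrite epsE size_map.
have le_k0 : (k0 <= k)%N by rewrite -size_eps find_size.
have eps_nth j : (j < k)%N -> nth 0%N eps j = vdeg x`_j.
  by move=> lt_j; rewrite epsE (nth_map 0).
have eps_eq0 j : (j < k0)%N -> vdeg x`_j = 0%N.
  move=> lt_j; rewrite -eps_nth ?(leq_trans lt_j) //.
  by have /negbFE/eqP := before_find 0%N lt_j.
have eps_k0 : (k0 < k)%N -> vdeg x`_k0 != 0%N.
  by move=> lt_k0; rewrite -eps_nth //; apply: (@nth_find _ 0%N (fun d => d != 0%N)); rewrite has_find size_eps.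
have dim_kernel : \dim (lker (linfun (omega A B))) = k0.
  have [N N_free NP] := constant_solutions A_skew B_skew x_min le_k0 eps_eq0 eps_k0.
  rewrite -(eqP N_free) -dim_rowvs; congr (\dim _); apply/vspaceP => w.
  rewrite mem_rowvs NP memv_ker lfunE /= /omega.
  by rewrite -(trmx_eq0 (w *m A)) -(trmx_eq0 (w *m B)) -row_mx_eq0.
have sum_eps : (\sum_(d <- eps | d != 0) (d - 1) + (k - k0) = \sum_j e j)%N.
  have := @sum_predn_nonzero eps k0; rewrite size_eps => -> //.
  - by rewrite epsE big_map (big_nth 0) big_mkord.
  - by move=> j lt_j; rewrite -(eps_eq0 j lt_j) -eps_nth // (leq_trans lt_j).
  move=> j /andP[le_j lt_j]; have lt_k0 : (k0 < k)%N by apply: leq_ltn_trans lt_j.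
  suff : vdeg x`_j != 0%N by rewrite -eps_nth.
  rewrite -lt0n; apply: leq_trans (minimal_indices_mono x_min (i := k0) _).
    by rewrite lt0n eps_k0.
  by rewrite le_j.
have sum_es : (\sum_(d <- es) (d - 1) + size es = \sum_(d <- es) d)%N.
  by apply: sum_predn_pos; apply/allP => d /es_gt0.
have sum_afs : (\sum_(af <- afs) (af.2 - 1) + size afs = \sum_(af <- afs) af.2)%N.
  by apply: sum_predn_pos; apply/allP => af /afs_gt0.
have sum_rank : (\sum_(a <- s) \rank (A + a *: B)%R + 2 * size afs = size s * r)%N.
  have <- : (\sum_(a <- s) count (fun af => af.1 == a) afs)%N = size afs.
    rewrite -(size_map (fun af => af.1) afs) -sum_count_undup.
    by apply: eq_bigr => a _; rewrite count_map.
  rewrite big_distrr -big_split /= (eq_bigr (fun=> r)) => [|a _]; last by rewrite addnC rank_s.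
  by rewrite big_const_seq count_predT iter_addn_0 mulnC.
rewrite dim_AID (dim_Inn g_nil xy_basis y_basis lie_t) dim_kernel.
have {}dimL : (n * 2 + \rank B + \sum_(a <- s) \rank (A + a *: B)%R =
    \dim (local_space A B Z e 1 s) + (2 * k + \sum_j e j) + (r + size s * r))%N.
  by rewrite -mulSn rE; apply: dimL.
have arith dL rB sr S SE SF pS pE pF m : (n * 2 + rB + sr = dL + (2 * k + S) + (r + m) ->
    sr + 2 * size afs = m -> 2 * size es + rB = r -> r = 2 * S + 2 * SE + 2 * SF ->
    pS + (k - k0) = S -> pE + size es = SE -> pF + size afs = SF ->
    dL = (n - k0) + pS + 2 * pE + 2 * pF)%N.
  by move: rk le_k0; clear; move: (size afs) (size es) r k k0 => *; lia.
exact: arith dimL sum_rank rank_oo r_formula sum_eps sum_es sum_afs.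
Qed.
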